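(* Let $\mathcal{T}=(S,s_{\mathit{init}},\to,L)$ be a finite transition system, let $E\subseteq S$ be a set of terminal states, let $C\subseteq S$ be a set of states disjoint from $E$, and let $\Phi=\Diamond E$ or $\Phi=\Box\neg E$. Let $\pi=s_0\dots s_n$ be a finite maximal path (execution) of $\mathcal{T}$ that visits $C$ and satisfies $\Phi$. Then it is decidable in polynomial time whether $C$ is a $d_{\mathit{pref}}^{\mathsf{AP}}$-counterfactual cause for $\Phi$ on $\pi$.
   Context: A transition system is $\mathcal{T}=(S,s_{\mathit{init}},\to,L)$ with finite state set $S$, initial state $s_{\mathit{init}}$, transition relation $\to\subseteq S\times S$ and labeling $L\colon S\to 2^{\mathsf{AP}}$. A path is a finite or infinite sequence of states $s_0s_1\dots$ with $s_0=s_{\mathit{init}}$ and $(s_i,s_{i+1})\in\to$ for all suitable $i$; its trace is $L(s_0)L(s_1)\dots$. A state is terminal if it has no outgoing transitions; a maximal path is an infinite path or a finite path ending in a terminal state. $\Diamond E$ means the path visits $E$, $\Box\neg E$ means it never visits $E$. For a distance function $d$ on maximal paths (i.e. $d(x,x)=0$, $d(x,y)=d(y,x)$, values in $\mathbb{R}_{\ge0}\cup\{\infty\}$), given a maximal path $\pi$ visiting $C$ and satisfying $\Phi$, $C$ is a $d$-counterfactual cause for $\Phi$ on $\pi$ if (1) there is a maximal path of $\mathcal{T}$ not visiting $C$, and (2) every maximal path $\rho$ with $\rho\models\Box\neg C$ such that $d(\pi,\rho)\le d(\pi,\rho')$ for all maximal $\rho'$ with $\rho'\models\Box\neg C$ satisfies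 $\rho\models\neg\Phi$. The prefix metric on traces is $d_{\mathit{pref}}^{\mathsf{AP}}(\pi,\rho)=2^{-n(\pi,\rho)}$, where $n(\pi,\rho)$ is the length of the longest common prefix of the traces $L(\pi)$ and $L(\rho)$. *)

(* Defs.v *)
From HB Require Import structures.
From mathcomp Require Import all_boot all_order all_algebra.
From mathcomp Require Import boolp reals constructive_ereal.

Set Implicit Arguments.
Unset Strict Implicit.
Unset Printing Implicit Defensive.

Import Order.TTheory GRing.Theory Num.Theory.

Local Open Scope ring_scope.

(* Random access machines over the natural numbers with addition and truncated
   subtraction, at unit cost per instruction. Since there is no multiplication,
   [t] steps only produce numbers of [O(t)] bits more than the input and the
   program contain, so polynomial time on this model is polynomial time on
   Turing machines. *)
Inductive instr :=
| Iconst of nat & nat        (* r_i <- c *)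
| Iadd of nat & nat & nat    (* r_i <- r_j + r_k *)
| Isub of nat & nat & nat    (* r_i <- max(r_j - r_k, 0) *)
| Iload of nat & nat         (* r_i <- r_(r_j) *)
| Istore of nat & nat        (* r_(r_i) <- r_j *)
| Iread of nat & nat         (* r_i <- r_j-th input number, 0 beyond the end *)
| Ijump of nat               (* go to instruction l *)
| Ijzero of nat & nat.       (* if r_i = 0 go to instruction l *)

Definition program := seq instr.

Record config := Config { pc : nat; regs : nat -> nat }.

Definition set_reg (r : nat -> nat) (i v : nat) : nat -> nat :=
  fun k => if k == i then v else r k.

Definition exec (w : seq nat) (ins : instr) (c : config) : config :=
  let r := regs c in
  let next i v := Config (pc c).+1 (set_reg r i v) in
  match ins with
  | Iconst i v => next i v
  | Iadd i j k => next i (r j + r k)%N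
  | Isub i j k => next i (r j - r k)%N
  | Iload i j => next i (r (r j))
  | Istore i j => next (r i) (r j)
  | Iread i j => next i (nth 0%N w (r j))
  | Ijump l => Config l r
  | Ijzero i l => Config (if r i == 0%N then l else (pc c).+1) r
  end.

(* The machine halts when the program counter leaves the program; halted
   configurations are fixed points of [step]. *)
Definition halted (P : program) (c : config) : bool := (size P <= pc c)%N.

Definition step (P : program) (w : seq nat) (c : config) : config :=
  if onth P (pc c) is Some ins then exec w ins c else c.

Definition config_after (P : program) (w : seq nat) (t : nat) : config :=
  iter t (step P w) (Config 0%N (fun=> 0%N)).

(* Total number of bits of the input numbers ([0] counts as one bit). *)
Definition input_size (w : seq nat) : nat :=
  (\sum_(x <- w) (trunc_log 2 x).+1)%N.

(* Instances are the [x : X] satisfying [dom], presented to the machine as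
   [enc x]; a nonzero value in register 0 on halting means "yes". *)
Definition polytime_decidable (X : Type) (enc : X -> seq nat)
    (dom Q : X -> Prop) : Prop :=
  exists (P : program) (p : {poly nat}), forall x : X, dom x ->
    let c := config_after P (enc x) p.[input_size (enc x)] in
    halted P c /\ (regs c 0%N != 0%N <-> Q x).

Record transition_system (S AP : finType) := TransitionSystem {
  init : S;
  trans : rel S;
  label : S -> {set AP}
}.

(* Finite or infinite sequences. *)
Inductive run (A : Type) := Fin of seq A | Inf of nat -> A.

Definition run_at (A : Type) (r : run A) (i : nat) : option A :=
  match r with Fin s => onth s i | Inf f => Some (f i) end.

Definition map_run (A B : Type) (g : A -> B) (r : run A) : run B :=
  match r with Fin s => Fin (map g s) | Inf f => Inf (g \o f) end.

Definition is_prefix (A : eqType) (u : seq A) (r : run A) : bool :=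
  match r with Fin s => prefix u s | Inf f => u == mkseq f (size u) end.

Definition common_prefix_length (A : eqType) (v w : run A) (k : nat) : Prop :=
  exists u : seq A, [/\ size u = k, is_prefix u v & is_prefix u w].

Definition longest_common_prefix_length (A : eqType) (v w : run A) (k : nat) :=
  common_prefix_length v w k /\
  forall j, common_prefix_length v w j -> (j <= k)%N.

(* [None] stands for infinity: [v] and [w] are infinite and equal. *)
Definition lcp_length (A : eqType) (v w : run A) : option nat :=
  if pselect (exists k, longest_common_prefix_length v w k) is left ex
  then Some (projT1 (cid ex)) else None.

Section Paths.
Variables (S AP : finType) (T : transition_system S AP).

Definition terminal (s : S) : Prop := forall t, ~~ trans T s t.

Definition is_path (r : run S) : Prop :=
  run_at r 0%N = Some (init T) /\
  forall i s t, run_at r i = Some s -> run_at r i.+1 = Some t -> trans T s t.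

Definition maximal_path (r : run S) : Prop :=
  is_path r /\
  if r is Fin p then terminal (last (init T) p) else True.

Definition trace (r : run S) : run {set AP} := map_run (label T) r.

Definition visits (A : {set S}) (r : run S) : Prop :=
  exists i s, run_at r i = Some s /\ s \in A.

Record distance (R : realType) := Distance {
  dist :> run S -> run S -> \bar R;
  dist_ge0 : forall x y, maximal_path x -> maximal_path y ->
    (0 <= dist x y)%E;
  dist_refl : forall x, maximal_path x -> dist x x = 0%E;
  dist_sym : forall x y, maximal_path x -> maximal_path y ->
    dist x y = dist y x
}.

Definition counterfactual_cause (R : realType) (d : distance R)
    (C : {set S}) (Phi : run S -> Prop) (pi : run S) : Prop :=
  (exists rho, maximal_path rho /\ ~ visits C rho) /\
  (forall rho, maximal_path rho -> ~ visits C rho ->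
    (forall rho', maximal_path rho' -> ~ visits C rho' ->
       (d pi rho <= d pi rho')%E) ->
    ~ Phi rho).

(* For a finite path [x] the formula [2 ^- n] alone gives a nonzero [d x x],
   hence the separate diagonal case. Distinct paths with equal finite traces
   are at distance [2 ^- n], [n] being the length of these traces. *)
Definition dpref_val (R : realType) (x y : run S) : \bar R :=
  if `[< x = y >] then 0%E
  else if lcp_length (trace x) (trace y) is Some n then (2 ^- n)%:E else 0%E.

Lemma dpref_ge0 (R : realType) x y : (0 <= dpref_val R x y)%E.
Proof.
rewrite /dpref_val; case: asbool => //; case: lcp_length => // n.
by rewrite lee_fin invr_ge0 exprn_ge0.
Qed.

Lemma dpref_refl (R : realType) x : dpref_val R x x = 0%E.
Proof. by rewrite /dpref_val asboolT. Qed.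

Lemma lcp_lengthC (A : eqType) (v w : run A) : lcp_length v w = lcp_length w v.
Proof.
have cpC k : common_prefix_length v w k = common_prefix_length w v k.
  by apply/propext; split=> -[u [? ? ?]]; exists u.
rewrite /lcp_length; suff -> : longest_common_prefix_length v w =
  longest_common_prefix_length w v by [].
apply/funext => k; rewrite /longest_common_prefix_length cpC.
by apply/propext; split=> -[? h]; split=> // j cj; apply: h;
  [rewrite cpC|rewrite -cpC].
Qed.

Lemma dpref_sym (R : realType) x y : dpref_val R x y = dpref_val R y x.
Proof.
rewrite /dpref_val lcp_lengthC.
by have -> : (x = y) = (y = x) by apply/propext; split.
Qed.

Definition dpref (R : realType) : distance R :=
  Distance (fun x y _ _ => dpref_ge0 R x y) (fun x _ => dpref_refl R x)
    (fun x y _ _ => dpref_sym R x y).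

End Paths.

Inductive objective := Reach | Avoid.

Definition objective_sat (S : finType) (E : {set S}) (o : objective)
    (r : run S) : Prop :=
  match o with Reach => visits E r | Avoid => ~ visits E r end.

(* The data of an instance, with states and atomic propositions numbered. *)
Record cf_data := CfData {
  nstates : nat;
  nprops : nat;
  ts : transition_system 'I_nstates 'I_nprops;
  effect : {set 'I_nstates};
  cause : {set 'I_nstates};
  obj : objective;
  execution : seq 'I_nstates
}.

(* Relations, labelings and sets are listed as 0/1 tables, row by row. *)
Definition encode (x : cf_data) : seq nat :=
  [:: nstates x; nprops x; nat_of_ord (init (ts x));
      if obj x is Reach then 0%N else 1%N]
  ++ [seq nat_of_bool (trans (ts x) s t)
       | s <- enum 'I_(nstates x), t <- enum 'I_(nstates x)]
  ++ [seq nat_of_bool (a \in label (ts x) s)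
       | s <- enum 'I_(nstates x), a <- enum 'I_(nprops x)]
  ++ [seq nat_of_bool (s \in effect x) | s <- enum 'I_(nstates x)]
  ++ [seq nat_of_bool (s \in cause x) | s <- enum 'I_(nstates x)]
  ++ size (execution x) :: [seq nat_of_ord s | s <- execution x].

(* Main.v *)
Require Import Defs.
From mathcomp Require Import all_boot all_order all_algebra.
From mathcomp Require Import boolp reals constructive_ereal zify.

(** The maximal paths avoiding [C] at minimal distance from the execution are
    those whose traces share the longest prefix with its trace. Let [G] be the
    set of states from which some maximal path avoids [C] (a greatest fixed
    point), [H] the set of those from which some such path also satisfies the
    objective (a least fixed point for [Reach], a greatest one for [Avoid]), and
    [R_k] the set of states reachable in [k] steps that avoid [C] and match the
    first [k + 1] labels of the execution. As effect states are terminal, a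
    path avoiding [C] that shares [k + 1] labels with the execution and
    satisfies the objective exists iff [R_k] meets [H], and without the
    objective iff it meets [G]. So [C] is a cause iff the initial state is in
    [G] and there is no [k] such that [R_k] meets [H] while [R_(k+1)] does not
    meet [G]. These sets are tabulated by nested loops whose bounds are at most
    the input size, so the running time is polynomial by induction on the
    program. *)

Set Implicit Arguments.
Unset Strict Implicit.
Unset Printing Implicit Defensive.

Import Order.TTheory GRing.Theory Num.Theory.

(** * Runs and fixed points *)

Lemma nth_onth (A : Type) (a : A) s i : i < size s -> onth s i = Some (nth a s i).
Proof. by move=> h; rewrite onthE (nth_map a). Qed.

Lemma onth_Some (A : Type) (a : A) s i b :
  onth s i = Some b -> i < size s /\ nth a s i = b.
Proof. by move=> h; rewrite -onthTE h; split=> //; apply: onth_nth h. Qed.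

Section RunPrefix.
Variables (A : eqType) (a : A).

Lemma is_prefixP (u : seq A) (r : run A) :
  is_prefix u r <-> forall i, i < size u -> run_at r i = Some (nth a u i).
Proof.
case: r => [s|f] /=.
  split=> [/prefixP[v ->] i iu|H].
    by rewrite (nth_onth a) ?size_cat ?nth_cat ?iu //; lia.
  apply/prefixP; exists (drop (size u) s).
  rewrite -[LHS](cat_take_drop (size u)); congr (_ ++ _).
  have us : size u <= size s.
    case: (posnP (size u)) => [-> //|u0]; rewrite -(prednK u0).
    by rewrite -onthTE H ?prednK.
  apply: (@eq_from_nth _ a) => [|i]; rewrite size_takel // => iu.
  rewrite nth_take //; have := H _ iu.
  by move=> /(onth_Some a)[].
split=> [/eqP -> i|H].
  by rewrite size_mkseq => iu; rewrite nth_mkseq.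
apply/eqP/(@eq_from_nth _ a) => [|i iu]; first by rewrite size_mkseq.
by rewrite nth_mkseq //; have [] := H i iu.
Qed.

End RunPrefix.

Lemma run_at_map (A B : Type) (g : A -> B) r i :
  run_at (map_run g r) i = omap g (run_at r i).
Proof. by case: r => [s|f] //=; apply: onth_map. Qed.

Section Paths.
Variables (S AP : finType) (T : transition_system S AP).
Implicit Types (X Y W C E : {set S}) (r rho : run S) (u : seq S) (s t : S).

Definition dead_end s : bool := [forall t, ~~ trans T s t].
Definition dead : {set S} := [set s | dead_end s].

Lemma terminalP s : reflect (terminal T s) (dead_end s).
Proof. exact: forallP. Qed.

(** The one-step operator of CTL: its least fixed point is [E (X U (X & Y))], and for [Y] the dead
    ends its greatest fixed point is [EG X] over maximal paths. *)
Definition pre X Y W : {set S} :=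
  [set s in X | (s \in Y) || [exists t, trans T s t && (t \in W)]].

(** A monotone chain of subsets of [S] changes at most [#|S|] times, so this many iterations reach
    the fixed point, and a bounded loop can compute it. *)
Definition lfp X Y := iter #|S| (pre X Y) set0.
Definition gfp X Y := iter #|S| (pre X Y) setT.

Lemma preS X Y : {homo pre X Y : V W / V \subset W}.
Proof.
move=> V W VW; apply/subsetP => s; rewrite !inE => /andP[-> /=].
case/orP=> [->//|/existsP[t /andP[st tV]]]; apply/orP; right.
by apply/existsP; exists t; rewrite st (subsetP VW).
Qed.

Lemma lfpE X Y : pre X Y (lfp X Y) = lfp X Y.
Proof. exact: (fixsetK (@preS X Y)). Qed.

(** By duality: the complements of the iterates from [setT] are the iterates of the dual operator
    from [set0]. *)
Lemma gfpE X Y : pre X Y (gfp X Y) = gfp X Y.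
Proof.
have iterC k : iter k (pre X Y) setT = ~: iter k (funsetC (pre X Y)) set0.
  by elim: k => [|k IH] /=; rewrite ?setC0 // IH setCK.
have := cofixsetK (@preS X Y).
by rewrite /cofixset /fixset -iterC.
Qed.

Lemma gfp_max X Y W : W \subset pre X Y W -> W \subset gfp X Y.
Proof.
move=> H; rewrite /gfp; elim: #|S| => [|k IH] /=; first exact: subsetT.
exact: subset_trans H (preS _ _ IH).
Qed.

(** * Maximal extensions of finite paths *)

Definition stays X r := forall i s, run_at r i = Some s -> s \in X.

Lemma not_visitsP C r : ~ visits C r <-> stays (~: C) r.
Proof.
split=> [H i s ri|H [i [s [ri sC]]]].
  by rewrite inE; apply/negP => sC; apply: H; exists i, s.
by have := H _ _ ri; rewrite inE sC.
Qed.

(** The sequence [h] is cut at its first dead end from index [l] on, or kept as an infinite run if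
    there is none. What [h] does after a dead end is thus irrelevant, which lets callers define it
    by a total successor function. *)
Lemma maximal_of_fun X (h : nat -> S) l : h 0 = init T ->
  (forall i, i < l -> trans T (h i) (h i.+1)) ->
  (forall i, l <= i -> ~~ dead_end (h i) -> trans T (h i) (h i.+1)) ->
  (forall i, h i \in X) ->
  exists rho, [/\ maximal_path T rho, stays X rho
    & forall i, i <= l -> run_at rho i = Some (h i)].
Proof.
move=> h0 hl hd hX.
have [ex|nex] := pselect (exists j, (l <= j) && dead_end (h j)).
  case: (ex_minnP ex) => j /andP[lj dj] jmin.
  have at_h i b : onth (mkseq h j.+1) i = Some b -> i <= j /\ h i = b.
    move=> /(onth_Some (h 0)); rewrite size_mkseq ltnS => -[ij <-].
    by rewrite nth_mkseq.
  exists (Fin (mkseq h j.+1)); split.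
  - split; last first.
      by apply/terminalP; rewrite -nth_last size_mkseq nth_mkseq.
    split; first by rewrite /= h0.
    move=> i s t /at_h[_ <-] /at_h[ij <-].
    case: (ltnP i l) => [|li]; first exact: hl.
    apply: hd => //; apply/negP => di.
    by have := jmin i; rewrite li di => /(_ isT); lia.
  - by move=> i s /at_h[_ <-].
  - move=> i il; have ij := leq_trans il lj.
    by rewrite [LHS](nth_onth (h 0)) ?nth_mkseq ?size_mkseq.
exists (Inf h); split=> //; last by move=> i s [<-].
split=> //; split=> [|i s t [<-] [<-]]; first by rewrite /= h0.
case: (ltnP i l) => [|li]; first exact: hl.
by apply: hd => //; apply/negP => di; apply: nex; exists i; rewrite li.
Qed.

Lemma path_size u : is_path T (Fin u) -> 0 < size u.
Proof. by case: u => //= -[]. Qed.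

Lemma path_trans u i : is_path T (Fin u) -> i.+1 < size u ->
  trans T (nth (init T) u i) (nth (init T) u i.+1).
Proof.
by move=> [_ H] iu; apply: (H i); apply: nth_onth => //; apply: ltnW.
Qed.

Lemma path_rcons u t : is_path T (Fin u) -> trans T (last (init T) u) t ->
  is_path T (Fin (rcons u t)).
Proof.
move=> Hu ut; have u0 := path_size Hu; split.
  by case: u Hu {ut u0} => [|s u] [].
move=> i a b /(onth_Some (init T))[_ <-] /(onth_Some (init T)).
rewrite size_rcons ltnS => -[iu <-]; rewrite !nth_rcons iu.
case: (ltngtP i.+1 (size u)) iu => // [iu|e] _; first exact: path_trans.
by rewrite -(nth_last (init T)) -e in ut.
Qed.

(** By the fixed point equation, a state of [gfp X dead] is a dead end or has a successor in the
    same set; after [u], such successors are followed forever. *)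
Lemma extend_gfp X u : is_path T (Fin u) -> stays X (Fin u) ->
  last (init T) u \in gfp X dead ->
  exists rho, [/\ maximal_path T rho, stays X rho & is_prefix u rho].
Proof.
move=> Hu uX; set s0 := last _ _ => s0G.
have u0 := path_size Hu.
(* The default [s] keeps [f] inside the fixed point at dead ends; the resulting stuttering is cut
   off by [maximal_of_fun]. *)
pose f s := odflt s [pick t | trans T s t && (t \in gfp X dead)].
(* Both branches would give [s0] at index [(size u).-1], so they join by a genuine step of [f]. *)
pose h i := if i < size u then nth (init T) u i else iter (i - (size u).-1) f s0.
have fG s : s \in gfp X dead -> f s \in gfp X dead.
  by rewrite /f; case: pickP => [t /andP[]|].
have fT s : s \in gfp X dead -> ~~ dead_end s -> trans T s (f s).
  rewrite -{1}gfpE !inE => /andP[_ /orP[->//|/existsP[t Ht]]] _.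
  by rewrite /f; case: pickP => [t' /andP[]|/(_ t)] //; rewrite Ht.
have hlast i : (size u).-1 <= i -> h i = iter (i - (size u).-1) f s0.
  rewrite /h; case: ltnP => // iu ui.
  have -> : i = (size u).-1 by lia.
  by rewrite subnn nth_last.
have hG i : (size u).-1 <= i -> h i \in gfp X dead.
  by move=> /hlast ->; elim: (i - _) => //= k; apply: fG.
have [||||rho [rm rX rp]] := @maximal_of_fun X h (size u).-1.
- by rewrite /h u0; case: u Hu {uX s0 s0G u0 h hlast hG} => [|s u] [] //= [].
- move=> i iu; rewrite /h !ifT; try lia.
  by apply: path_trans => //; lia.
- move=> i ui di; rewrite (hlast i.+1); last by lia.
  rewrite subSn // iterS -hlast //.
  exact/fT/di/hG.
- move=> i; case: (leqP (size u).-1 i) => [/hG|iu].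
    by rewrite -gfpE inE => /andP[].
  rewrite /h ifT; last by lia.
  by apply: (uX i); apply: nth_onth; lia.
exists rho; split=> //; apply/(is_prefixP (init T)) => i iu.
by rewrite rp /h ?iu // -ltnS prednK.
Qed.

(** Induction on the iterate containing the last state, for all [u]: either [u] already ends in [E],
    hence is maximal, or one step lowers the iterate. *)
Lemma extend_lfp X E u : (forall s, s \in E -> terminal T s) ->
  is_path T (Fin u) -> stays X (Fin u) -> last (init T) u \in lfp X E ->
  exists rho, [/\ maximal_path T rho, stays X rho, is_prefix u rho & visits E rho].
Proof.
move=> Et; rewrite /lfp; elim: #|S| u => [|k IH] u Hu uX /=; first by rewrite inE.
rewrite inE => /andP[_ /orP[uE|/existsP[t /andP[ut tk]]]].
  exists (Fin u); split; rewrite /= ?prefix_refl //; first by split=> //; apply: Et.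
  exists (size u).-1, (last (init T) u); split=> //.
  by rewrite -nth_last; apply: nth_onth; have := path_size Hu; lia.
have [|||rho [rm rX rp rE]] := IH (rcons u t).
- exact: path_rcons.
- move=> i s /(onth_Some (init T)); rewrite size_rcons nth_rcons ltnS => -[iu <-].
  case: ltngtP iu => // [iu|_] _; first by apply: (uX i); apply: nth_onth.
  (* The new state [t] is in [X] because it lies in an iterate of [pre]; the zeroth iterate is
     empty. *)
  case: k tk {IH} => [|k]; first by rewrite inE.
  by rewrite inE => /andP[].
- by rewrite last_rcons.
exists rho; split=> //; apply/(is_prefixP (init T)) => i iu.
move/(is_prefixP (init T)): rp => ->; last by rewrite size_rcons ltnW.
by rewrite nth_rcons iu.
Qed.

(** The states occurring on [rho] form a post-fixed point: each has its successor on [rho], or is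
    the last state and then, by maximality, a dead end. *)
Lemma maximal_stays_gfp X rho :
  maximal_path T rho -> stays X rho -> stays (gfp X dead) rho.
Proof.
move=> [[_ rstep] rlast] rX.
pose W := [set s | `[< exists i, run_at rho i = Some s >]].
have WG : W \subset gfp X dead.
  apply: gfp_max; apply/subsetP => s; rewrite !inE => /asboolP[i ri].
  rewrite (rX _ _ ri) /=.
  have [[t rt]|nt] := pselect (exists t, run_at rho i.+1 = Some t).
    apply/orP; right; apply/existsP; exists t; rewrite (rstep _ _ _ ri rt) inE.
    by apply/asboolP; exists i.+1.
  apply/orP; left; apply/terminalP.
  case: rho rlast ri nt {rstep rX W} => [p|f] rlast ri nt; last first.
    by case: nt; exists (f i.+1).
  have [ip <-] := onth_Some (init T) ri.
  have -> : i = (size p).-1.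
    case: (ltnP i.+1 (size p)) => [ip'|]; last by lia.
    by case: nt; exists (nth (init T) p i.+1); apply: nth_onth.
  by rewrite nth_last.
move=> i s ri; apply: (subsetP WG); rewrite inE; apply/asboolP; by exists i.
Qed.

(** Backward induction along the path from the visit of [E], on the difference [j - i]. *)
Lemma path_stays_lfp X E rho i j s e : is_path T rho -> stays X rho ->
  run_at rho j = Some e -> e \in E -> i <= j -> run_at rho i = Some s ->
  s \in lfp X E.
Proof.
move=> [_ rstep] rX rj eE ij.
have [k jk] : exists k, j = k + i by exists (j - i); rewrite subnK.
rewrite jk {ij jk} in rj *; elim: k i s rj => [|k IH] i s rj ri.
  by rewrite -lfpE inE (rX _ _ ri); move: rj; rewrite add0n ri => -[->]; rewrite eE.
have [t rt] : exists t, run_at rho i.+1 = Some t.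
  case: rho rj ri {rstep rX IH} => [p|f] rj ri; last by exists (f i.+1).
  have [jp _] := onth_Some (init T) rj.
  by exists (nth (init T) p i.+1); apply: nth_onth; lia.
rewrite -lfpE inE (rX _ _ ri); apply/orP; right; apply/existsP; exists t.
by rewrite (rstep _ _ _ ri rt) (IH i.+1) // -addSnnS.
Qed.

(** With [X] the complement of [C], this is [R_k]. The default of [nth] intervenes only from
    [size p] on, and [meets_gfp] and [meets_good_obj] assume [k < size p]. *)
Fixpoint matching X (p : seq S) (k : nat) : {set S} :=
  [set s in X | (label T s == label T (nth (init T) p k))
    && (if k is l.+1 then [exists t in matching X p l, trans T t s]
        else s == init T)].

Lemma matchingS X p k s : s \in matching X p k ->
  s \in X /\ label T s = label T (nth (init T) p k).
Proof. by case: k => [|k] /=; rewrite inE => /andP[-> /andP[/eqP]]. Qed.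

(** Supplies the finite path that [extend_gfp] and [extend_lfp] prolong. *)
Lemma matching_path X p k s : s \in matching X p k -> exists u,
  [/\ is_path T (Fin u), size u = k.+1, last (init T) u = s, stays X (Fin u)
    & forall i, i <= k -> label T (nth (init T) u i) = label T (nth (init T) p i)].
Proof.
elim: k s => [|k IH] s sk; have [sX sL] := matchingS sk.
  move: sk; rewrite /= inE => /andP[_ /andP[_ /eqP sI]].
  exists [:: s]; split=> //.
  - by split; rewrite /= ?sI // => -[|[]].
  - by move=> [|[]] //= t [<-].
  - by move=> [].
move: sk; rewrite /= inE => /andP[_ /andP[_ /existsP[t /andP[tk ts]]]].
have [u [Hu su ut uX uL]] := IH _ tk.
exists (rcons u s); split.
- by apply: path_rcons => //; rewrite ut.
- by rewrite size_rcons su.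
- by rewrite last_rcons.
- move=> i b /(onth_Some (init T)); rewrite size_rcons nth_rcons ltnS => -[iu <-].
  by case: ltngtP iu => // iu _; apply: (uX i); apply: nth_onth.
- move=> i; rewrite leq_eqVlt nth_rcons su => /orP[/eqP ->|ik].
    by rewrite ltnn eqxx.
  by rewrite ik; apply: uL.
Qed.

Lemma path_matching X p k s rho : is_path T rho -> stays X rho ->
  (forall i, i <= k -> exists2 t, run_at rho i = Some t
     & label T t = label T (nth (init T) p i)) ->
  run_at rho k = Some s -> s \in matching X p k.
Proof.
move=> [r0 rstep] rX; elim: k s => [|k IH] s rL rk /=; rewrite inE (rX _ _ rk).
  have [t] := rL 0 isT; rewrite rk => -[<-] ->.
  by move: rk; rewrite r0 => -[<-]; rewrite !eqxx.
have [t] := rL k.+1 (leqnn _); rewrite rk => -[<-] ->; rewrite eqxx /=.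
have [b rb _] := rL k (leqnSn k).
apply/existsP; exists b; rewrite (rstep _ _ _ rb rk) andbT; apply: IH => // i ik.
exact/rL/leqW.
Qed.

(** * Common prefixes of traces and comparison of distances *)

Lemma common_prefix_traceP p rho j :
  common_prefix_length (trace T (Fin p)) (trace T rho) j <->
  j <= size p /\ forall i, i < j -> exists2 s, run_at rho i = Some s
    & label T s = label T (nth (init T) p i).
Proof.
split=> [[u [<- up ur]]|[jp H]].
  have us : size u <= size p.
    by move: up => /prefixP[v e]; rewrite -(size_map (label T) p) e size_cat leq_addr.
  split=> // i iu; move/(is_prefixP set0): up => /(_ i iu).
  rewrite run_at_map /= (nth_onth (init T)) ?(leq_trans iu) //= => -[->].
  move/(is_prefixP set0): ur => /(_ i iu); rewrite run_at_map.
  by case: (run_at rho i) => //= s [<-]; exists s.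
exists (map (label T) (take j p)); split.
- by rewrite size_map size_takel.
- rewrite /= -{2}(cat_take_drop j p) map_cat; exact: prefix_prefix.
apply/(is_prefixP set0) => i; rewrite size_map size_takel // => ij.
have [s rs ls] := H i ij; rewrite run_at_map rs /= ls.
by rewrite (nth_map (init T)) ?size_takel // nth_take.
Qed.

(** The common prefix lengths are bounded by [size p], so a longest one exists, and they are closed
    downwards, so it determines all of them. *)
Lemma lcp_length_trace p rho : exists2 n,
  lcp_length (trace T (Fin p)) (trace T rho) = Some n
  & forall j, common_prefix_length (trace T (Fin p)) (trace T rho) j <-> j <= n.
Proof.
set cpl := common_prefix_length _ _.
have cpl0 : exists j, `[< cpl j >].
  by exists 0; apply/asboolP/common_prefix_traceP; split.
have cpl_le j : `[< cpl j >] -> j <= size p.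
  by move=> /asboolP/common_prefix_traceP[].
have ex : exists k, longest_common_prefix_length (trace T (Fin p)) (trace T rho) k.
  case: (ex_maxnP cpl0 cpl_le) => k /asboolP ck kmax; exists k; split=> // j cj.
  exact/kmax/asboolP.
rewrite /lcp_length; case: pselect => // ex'; case: cid => k [ck kmax] /=.
exists k => // j; split; first exact: kmax.
move=> jk; apply/common_prefix_traceP.
move/common_prefix_traceP: ck => [kp H]; split; first exact: leq_trans kp.
by move=> i ij; apply/H/(leq_trans ij).
Qed.

(** Since [2 ^- n] decreases in [n], comparing distances amounts to comparing sets of common prefix
    lengths in the opposite direction. The two inequalities exclude the diagonal case of
    [dpref_val]. *)
Lemma dpref_le (R : realType) p rho rho' : Fin p <> rho -> Fin p <> rho' ->
  (dpref T R (Fin p) rho <= dpref T R (Fin p) rho')%E <->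
  forall j, common_prefix_length (trace T (Fin p)) (trace T rho') j ->
            common_prefix_length (trace T (Fin p)) (trace T rho) j.
Proof.
move=> ne ne'; rewrite /= /dpref_val !asboolF //.
have [n -> Hn] := lcp_length_trace p rho.
have [n' -> Hn'] := lcp_length_trace p rho'.
rewrite lee_fin lef_pV2 ?posrE ?exprn_gt0 // ler_eXn2l ?ltr1n //.
split=> [nn j /Hn' jn|H]; first by apply/Hn/(leq_trans jn).
by apply/Hn/H/Hn'.
Qed.

End Paths.

(** * Counterfactual causes for the prefix metric *)

Section Causality.
Variables (S AP : finType) (T : transition_system S AP).
Variables (C E : {set S}) (o : objective) (p : seq S).
Hypothesis E_terminal : forall s, s \in E -> terminal T s.

(** The set [H]. For [Reach], a path is maximal as soon as it enters [E], because effect states are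
    terminal. *)
Definition good_obj : {set S} :=
  match o with
  | Reach => lfp T (~: C) E
  | Avoid => gfp T (~: C :&: ~: E) (dead T)
  end.

Definition meets k (W : {set S}) : bool :=
  [exists s, (s \in matching T (~: C) p k) && (s \in W)].

Let agrees k rho := common_prefix_length (trace T (Fin p)) (trace T rho) k.

Lemma agrees_extend u rho k : k < size p -> size u = k.+1 ->
  (forall i, i <= k -> label T (nth (init T) u i) = label T (nth (init T) p i)) ->
  is_prefix u rho -> agrees k.+1 rho.
Proof.
move=> kp su uL /(is_prefixP (init T)) up; apply/common_prefix_traceP; split=> //.
by move=> i ik; exists (nth (init T) u i); [apply: up; rewrite su|apply: uL].
Qed.

Lemma agrees_matching X k rho : is_path T rho -> stays X rho -> agrees k.+1 rho ->
  exists2 s, run_at rho k = Some s & s \in matching T X p k.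
Proof.
move=> Hr rX /common_prefix_traceP[_ H].
have [s rs _] := H k (leqnn _); exists s => //.
by apply: path_matching rs => // i ik; apply: H.
Qed.

Lemma meets_gfp k : k < size p ->
  meets k (gfp T (~: C) (dead T)) <->
  exists rho, [/\ maximal_path T rho, ~ visits C rho & agrees k.+1 rho].
Proof.
move=> kp; split.
  move=> /existsP[s /andP[/matching_path[u [Hu su us uC uL]] sG]].
  rewrite -us in sG; have [rho [rm rC ru]] := extend_gfp Hu uC sG.
  by exists rho; split=> //; [apply/not_visitsP|apply: agrees_extend ru].
move=> [rho [rm /not_visitsP rC ra]].
have [s rs sk] := agrees_matching rm.1 rC ra.
by apply/existsP; exists s; rewrite sk (maximal_stays_gfp rm rC rs).
Qed.

(** A state of [E] has no successor, so it can only be the last one. *)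
Lemma path_avoids_terminals u : is_path T (Fin u) -> last (init T) u \notin E ->
  stays (~: E) (Fin u).
Proof.
move=> Hu uE i s /(onth_Some (init T))[iu <-]; rewrite inE.
case: (ltnP i.+1 (size u)) => [iu'|ui].
  by apply/negP => /E_terminal/(_ (nth (init T) u i.+1)); rewrite path_trans.
have -> : i = (size u).-1 by lia.
by rewrite nth_last.
Qed.

(** The objective concerns the whole path, but the states before index [k] have successors and so
    lie outside [E]: the state at index [k] alone decides whether a suitable continuation exists. *)
Lemma meets_good_obj k : k < size p ->
  meets k good_obj <->
  exists rho, [/\ maximal_path T rho, ~ visits C rho, agrees k.+1 rho
                & objective_sat E o rho].
Proof.
move=> kp; rewrite /good_obj; case: o; split.
- move=> /existsP[s /andP[/matching_path[u [Hu su us uC uL]] sG]].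
  rewrite -us in sG; have [rho [rm rC ru rE]] := extend_lfp E_terminal Hu uC sG.
  by exists rho; split=> //; [apply/not_visitsP|apply: agrees_extend ru].
- move=> [rho [rm /not_visitsP rC ra [j [e [rj eE]]]]].
  have [s rs sk] := agrees_matching rm.1 rC ra.
  apply/existsP; exists s; rewrite sk.
  apply: (path_stays_lfp rm.1 rC rj eE) rs.
  (* If [E] were visited at [j < k], the agreement up to [k] would provide a successor of the
     terminal state [e]. *)
  rewrite leqNgt; apply/negP => jk.
  have [_ H] := (iffLR (common_prefix_traceP _ _ _ _)) ra.
  have [t rt _] := H j.+1 jk.
  by have := E_terminal eE t; rewrite (rm.1.2 j e t).
- move=> /existsP[s /andP[/matching_path[u [Hu su us uC uL]] sG]].
  have uE : last (init T) u \notin E.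
    by rewrite us; move: sG; rewrite -gfpE !inE => /andP[/andP[]].
  rewrite -us in sG; have [|rho [rm rX ru]] := extend_gfp Hu _ sG.
    by move=> i t ut; rewrite inE (uC _ _ ut) (path_avoids_terminals Hu uE ut).
  exists rho; split=> //.
  + by apply/not_visitsP => i t /rX; rewrite inE => /andP[].
  + exact: agrees_extend ru.
  + by apply/not_visitsP => i t /rX; rewrite inE => /andP[].
- move=> [rho [rm /not_visitsP rC ra /not_visitsP rE]].
  have rX : stays (~: C :&: ~: E) rho.
    by move=> i t rt; rewrite inE (rC _ _ rt) (rE _ _ rt).
  have [s rs sk] := agrees_matching rm.1 rC ra.
  by apply/existsP; exists s; rewrite sk (maximal_stays_gfp rm rX rs).
Qed.

Hypothesis p_path : maximal_path T (Fin p).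
Hypothesis p_cause : visits C (Fin p).

Lemma init_gfp : init T \in gfp T (~: C) (dead T) <->
  exists rho, maximal_path T rho /\ ~ visits C rho.
Proof.
split=> [iG|[rho [rm /not_visitsP rC]]].
  have Hu : is_path T (Fin [:: init T]) by split=> // -[|[]].
  have [|rho [rm rC _]] := extend_gfp Hu _ iG.
    by move=> [|[]] //= s [<-]; move: iG; rewrite -gfpE inE => /andP[].
  by exists rho; split=> //; apply/not_visitsP.
by apply: (maximal_stays_gfp rm rC (i := 0)); case: rm => -[].
Qed.

(** A closest path violating the second condition has some common prefix length [k + 1]: it is
    witnessed by [R_k] meeting [H], and its optimality by the absence of a path avoiding [C] that
    shares [k + 2] labels. *)
Lemma counterfactual_cause_dprefP (R : realType) :
  counterfactual_cause (dpref T R) C (objective_sat E o) (Fin p) <->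
  init T \in gfp T (~: C) (dead T) /\
  ~ exists k, [/\ k < size p, meets k good_obj
                & ~ (k.+1 < size p /\ meets k.+1 (gfp T (~: C) (dead T)))].
Proof.
have ne rho : ~ visits C rho -> Fin p <> rho by move=> rC e; apply: rC; rewrite -e.
have p0 := path_size p_path.1.
split=> -[/init_gfp H1 H2]; split=> //.
- move=> [k [kp /(meets_good_obj kp)[rho [rm rC ra rP]] nk]].
  apply: (H2 rho) => // rho' rm' rC'.
  apply/(dpref_le T R (ne _ rC) (ne _ rC')) => j ja.
  have jk : j <= k.+1.
    rewrite leqNgt; apply/negP => kj; apply: nk.
    have [n _ Hn] := lcp_length_trace T p rho'.
    have k2 : agrees k.+2 rho' by apply/Hn/(leq_trans kj)/Hn.
    have kp' : k.+1 < size p by move/common_prefix_traceP: k2 => [].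
    by split=> //; apply/(meets_gfp kp'); exists rho'.
  have [n _ Hn] := lcp_length_trace T p rho.
  by apply/Hn/(leq_trans jk)/Hn.
- move=> rho rm rC opt rP; apply: H2.
  have [n _ Hn] := lcp_length_trace T p rho.
  (* Both paths start in [init T], so their traces share the first label and [n.-1] is a genuine
     index. *)
  have n0 : 0 < n.
    apply/Hn/common_prefix_traceP; split=> // -[|//] _; exists (init T).
      by case: rm => -[].
    by case: (p) p0 p_path => //= s q _ [[]] /= [->].
  have np : n <= size p by have /common_prefix_traceP[] := (iffRL (Hn n)) (leqnn n).
  have kp : n.-1 < size p by rewrite prednK.
  exists n.-1; split=> //.
    apply/(meets_good_obj kp); exists rho; split=> //.
    by apply/Hn; rewrite prednK.
  rewrite prednK // => -[np' /(meets_gfp np')[rho' [rm' rC' ra']]].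
  (* Optimality of [rho] would transfer the [n + 1] shared labels of [rho'] to [rho], against the
     maximality of [n]. *)
  have := opt rho' rm' rC'; move/(dpref_le T R (ne _ rC) (ne _ rC'))/(_ _ ra')/Hn.
  by rewrite ltnn.
Qed.

End Causality.

(** * A loop language compiled to random access machines *)

(** Jump targets are absolute, so the generated code depends on its address [b]. *)
Definition code_at (P : program) (b : nat) (C : seq instr) : Prop :=
  forall i, i < size C -> onth P (b + i) = onth C i.

Lemma code_at_cat P b C1 C2 : code_at P b (C1 ++ C2) ->
  code_at P b C1 /\ code_at P (b + size C1) C2.
Proof.
move=> H; split=> i Hi.
  by rewrite H ?size_cat ?onth_cat ?Hi //; lia.
rewrite -addnA H ?size_cat ?ltn_add2l // onth_cat ifF; last by lia.
by congr (onth _ _); lia.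
Qed.

Lemma code_at_cons P b ins C : code_at P b (ins :: C) ->
  onth P b = Some ins /\ code_at P b.+1 C.
Proof.
move=> H; split; first by have := H 0 isT; rewrite addn0.
by move=> i Hi; have := H i.+1 Hi; rewrite addnS -addSn.
Qed.

(** An upper bound composes more easily than an exact step count; [within_halted] makes it exact at
    the end, as halted configurations are fixed points. *)
Definition within P w n c c' := exists2 t, t <= n & iter t (step P w) c = c'.

Lemma within_refl P w n c : within P w n c c.
Proof. by exists 0. Qed.

Lemma within_at P w n b b' r : b = b' -> within P w n (Config b r) (Config b' r).
Proof. by move=> ->; apply: within_refl. Qed.

Lemma within_trans P w n1 n2 c1 c2 c3 :
  within P w n1 c1 c2 -> within P w n2 c2 c3 -> within P w (n1 + n2) c1 c3.
Proof.
move=> [t1 h1 <-] [t2 h2 <-]; exists (t2 + t1); first by rewrite addnC leq_add.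
by rewrite iterD.
Qed.

Lemma within_le P w n1 n2 c c' : n1 <= n2 -> within P w n1 c c' -> within P w n2 c c'.
Proof. by move=> h [t h1 h2]; exists t => //; apply: leq_trans h1 h. Qed.

Lemma within_step P w n b r ins c' : onth P b = Some ins ->
  within P w n (exec w ins (Config b r)) c' -> within P w n.+1 (Config b r) c'.
Proof.
move=> H [t h1 h2]; exists t.+1 => //.
by rewrite iterSr {2}/step /= H.
Qed.

Lemma iter_halted P w t c : halted P c -> iter t (step P w) c = c.
Proof.
move=> H; elim: t => //= t ->; rewrite /step.
by case E: (onth P (pc c)) => [i|] //; move: H; rewrite /halted leqNgt -onthTE E.
Qed.

Lemma within_halted P w n c c' : within P w n c c' -> halted P c' ->
  iter n (step P w) c = c'.
Proof.
move=> [t h1 <-] H; rewrite -(subnK h1) iterD.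
exact: iter_halted.
Qed.

(* Naturals serve as names: [Sum x b e] is the sum of [e] for [x] ranging below
   the value of [b], and [For x b c] repeats [c] likewise. *)
Inductive expr :=
| Cst of nat
| Nm of nat
| Plus of expr & expr
| Minus of expr & expr
| Inp of expr
| Tab of 'I_3 & expr
| Sum of nat & nat & expr.

Inductive cmd :=
| Let of nat & expr & cmd
| Put of 'I_3 & expr & expr
| For of nat & nat & cmd
| Seq of cmd & cmd.

Definition store := 'I_3 -> nat -> nat.

Definition set_store (st : store) (a : 'I_3) (i v : nat) : store :=
  fun a' => if a' == a then set_reg (st a) i v else st a'.

Fixpoint eval (w : seq nat) (st : store) (rho : nat -> nat) (e : expr) : nat :=
  match e with
  | Cst c => c
  | Nm x => rho x
  | Plus e1 e2 => eval w st rho e1 + eval w st rho e2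
  | Minus e1 e2 => eval w st rho e1 - eval w st rho e2
  | Inp e => nth 0 w (eval w st rho e)
  | Tab a e => st a (eval w st rho e)
  | Sum x b e => \sum_(0 <= k < rho b) eval w st (set_reg rho x k) e
  end.

Fixpoint run_cmd (w : seq nat) (st : store) (rho : nat -> nat) (c : cmd) : store :=
  match c with
  | Let x e c => run_cmd w st (set_reg rho x (eval w st rho e)) c
  | Put a i e => set_store st a (eval w st rho i) (eval w st rho e)
  | For x b c =>
      foldl (fun st k => run_cmd w st (set_reg rho x k) c) st (iota 0 (rho b))
  | Seq c1 c2 => run_cmd w (run_cmd w st rho c1) rho c2
  end.

(* Temporaries occupy the registers divisible by 4, and the cells of table [a]
   those congruent to [a + 1]. *)
Definition temp (d : nat) : nat := d.*2.*2.
Definition cell (a : 'I_3) (i : nat) : nat := (i.*2.*2 + a).+1.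

(** Counter [i], bound [nb], scratch [u]. The exit test is that the truncated difference [nb - i]
    vanishes; the exit address counts two instructions before the body and three after it. *)
Definition loop_code (b i nb u : nat) (body : seq instr) : seq instr :=
  [:: Isub u nb i; Ijzero u (b + (size body + 5))] ++ body
  ++ [:: Iconst u 1; Iadd i i u; Ijump b].

(** Computes the register number [4 * i + a + 1] by two doublings, as the machine has no
    multiplication. *)
Definition cell_code (a : 'I_3) (i u : nat) : seq instr :=
  [:: Iadd i i i; Iadd i i i; Iconst u a.+1; Iadd i i u].

(* The value of an expression is left in temporary [d], and only temporaries
   from [d] on are modified; [sg] maps names to temporaries below [d]. *)
Fixpoint cexp (sg : nat -> nat) (d b : nat) (e : expr) : seq instr :=
  match e with
  | Cst c => [:: Iconst (temp d) c]
  | Nm x => [:: Iconst (temp d) 0; Iadd (temp d) (temp d) (temp (sg x))]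
  | Plus e1 e2 =>
      let C := cexp sg d b e1 in
      C ++ cexp sg d.+1 (b + size C) e2
      ++ [:: Iadd (temp d) (temp d) (temp d.+1)]
  | Minus e1 e2 =>
      let C := cexp sg d b e1 in
      C ++ cexp sg d.+1 (b + size C) e2
      ++ [:: Isub (temp d) (temp d) (temp d.+1)]
  | Inp e => cexp sg d b e ++ [:: Iread (temp d) (temp d)]
  | Tab a e => cexp sg d b e ++ cell_code a (temp d) (temp d.+1)
      ++ [:: Iload (temp d) (temp d)]
  | Sum x lim e =>
      [:: Iconst (temp d) 0; Iconst (temp d.+1) 0]
      ++ loop_code (b + 2) (temp d.+1) (temp (sg lim)) (temp d.+2)
           (cexp (set_reg sg x d.+1) d.+2 (b + 4) e
            ++ [:: Iadd (temp d) (temp d) (temp d.+2)])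
  end.

(** Temporaries form a stack: [Let] and [For] keep their value in temporary [d] and compile their
    body at depth [d.+1]. *)
Fixpoint ccmd (sg : nat -> nat) (d b : nat) (c : cmd) : seq instr :=
  match c with
  | Let x e c =>
      let C := cexp sg d b e in
      C ++ ccmd (set_reg sg x d) d.+1 (b + size C) c
  | Put a i e =>
      let C1 := cexp sg d b i in
      C1 ++ cexp sg d.+1 (b + size C1) e
      ++ cell_code a (temp d) (temp d.+2) ++ [:: Istore (temp d) (temp d.+1)]
  | For x lim c =>
      Iconst (temp d) 0
      :: loop_code b.+1 (temp d) (temp (sg lim)) (temp d.+1)
           (ccmd (set_reg sg x d) d.+1 (b + 3) c)
  | Seq c1 c2 =>
      let C := ccmd sg d b c1 in C ++ ccmd sg d (b + size C) c2
  end.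

(** Step bounds when all loop limits are at most [B]: [loop_code] costs five control steps per
    iteration and two for the final test. *)
Fixpoint etime (B : nat) (e : expr) : nat :=
  match e with
  | Cst _ => 1
  | Nm _ => 2
  | Plus e1 e2 | Minus e1 e2 => etime B e1 + (etime B e2 + 1)
  | Inp e => etime B e + 1
  | Tab a e => etime B e + 5
  | Sum _ _ e => 2 + (B * (etime B e + 1 + 5) + 2)
  end.

Fixpoint ctime (B : nat) (c : cmd) : nat :=
  match c with
  | Let _ e c => etime B e + ctime B c
  | Put _ i e => etime B i + (etime B e + 5)
  | For _ _ c => 1 + (B * (ctime B c + 5) + 2)
  | Seq c1 c2 => ctime B c1 + ctime B c2
  end.

(** Each loop contributes one factor ['X], so the degree is governed by the nesting depth of the
    fixed program. *)
Lemma etime_poly e : exists p : {poly nat}, forall B, p.[B]%R = etime B e.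
Proof.
elim: e => /= [_|_|e1 [p1 h1] e2 [p2 h2]|e1 [p1 h1] e2 [p2 h2]|e [p h]|_ e [p h]
  |_ _ e [p h]].
- by exists 1%:P%R => B; rewrite hornerC.
- by exists 2%:P%R => B; rewrite hornerC.
- by exists (p1 + (p2 + 1%:P))%R => B; rewrite !hornerD hornerC h1 h2.
- by exists (p1 + (p2 + 1%:P))%R => B; rewrite !hornerD hornerC h1 h2.
- by exists (p + 1%:P)%R => B; rewrite !hornerD hornerC h.
- by exists (p + 5%:P)%R => B; rewrite !hornerD hornerC h.
exists (2%:P + ('X * (p + 1%:P + 5%:P) + 2%:P))%R => B.
by rewrite !(hornerD, hornerC, hornerM, hornerX) h.
Qed.

Lemma ctime_poly c : exists p : {poly nat}, forall B, p.[B]%R = ctime B c.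
Proof.
elim: c => /= [_ e c [q hq]|_ i e|_ _ c [q hq]|c1 [q1 h1] c2 [q2 h2]].
- have [p hp] := etime_poly e.
  by exists (p + q)%R => B; rewrite hornerD hp hq.
- have [p1 h1] := etime_poly i; have [p2 h2] := etime_poly e.
  by exists (p1 + (p2 + 5%:P))%R => B; rewrite !hornerD hornerC h1 h2.
- exists (1%:P + ('X * (q + 5%:P) + 2%:P))%R => B.
  by rewrite !(hornerD, hornerC, hornerM, hornerX) hq.
- by exists (q1 + q2)%R => B; rewrite hornerD h1 h2.
Qed.

(** * Correctness and running time of compiled code *)

Definition frame (d : nat) (r r' : nat -> nat) : Prop :=
  (forall j, j < d -> r' (temp j) = r (temp j)) /\
  (forall a i, r' (cell a i) = r (cell a i)).

Definition represents (sg : nat -> nat) (d : nat) (st : store)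
    (rho r : nat -> nat) : Prop :=
  [/\ forall x, sg x < d, forall x, r (temp (sg x)) = rho x
    & forall a i, r (cell a i) = st a i].

Lemma temp_inj i j : (temp i == temp j) = (i == j).
Proof. rewrite /temp; lia. Qed.

Lemma cell_inj a i b j : (cell a i == cell b j) = (a == b) && (i == j).
Proof.
rewrite /cell -val_eqE /=; case: a b => [a Ha] [b Hb] /=; lia.
Qed.

Lemma cell_temp a i j : (cell a i == temp j) = false.
Proof. rewrite /cell /temp; case: a => [a Ha] /=; lia. Qed.

Lemma temp_cell a i j : (temp j == cell a i) = false.
Proof. by rewrite eq_sym cell_temp. Qed.

Lemma frame_trans d r1 r2 r3 : frame d r1 r2 -> frame d r2 r3 -> frame d r1 r3.
Proof. by move=> [h1 h2] [h3 h4]; split=> *; rewrite ?h3 ?h4 ?h1 ?h2. Qed.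

Lemma frame_refl d r : frame d r r.
Proof. by split. Qed.

Lemma frame_le d d' r r' : d <= d' -> frame d' r r' -> frame d r r'.
Proof. by move=> h [h1 h2]; split=> // j hj; apply: h1; apply: leq_trans h. Qed.

Lemma frame_set d d' r r' v :
  d <= d' -> frame d r r' -> frame d r (set_reg r' (temp d') v).
Proof.
move=> h [h1 h2]; split=> [j hj|a i]; rewrite /set_reg ?cell_temp ?h2 //.
by rewrite temp_inj ltn_eqF ?h1 //; apply: leq_trans hj h.
Qed.

Lemma represents_frame sg d st rho r r' :
  frame d r r' -> represents sg d st rho r -> represents sg d st rho r'.
Proof. by move=> [h1 h2] [h3 h4 h5]; split=> *; rewrite ?h1 ?h2 ?h4 ?h5. Qed.

Lemma represents_le sg d d' st rho r : d <= d' ->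
  represents sg d st rho r -> represents sg d' st rho r.
Proof. by move=> h [h1 h2 h3]; split=> // x; apply: leq_trans h. Qed.

Lemma represents_bind sg d st rho r x : represents sg d st rho r ->
  represents (set_reg sg x d) d.+1 st (set_reg rho x (r (temp d))) r.
Proof.
move=> [h1 h2 h3]; split=> [y|y|//]; rewrite /set_reg; case: ifP => // _.
exact: leqW.
Qed.

(** A Hoare rule with an invariant indexed by the number of completed iterations. It must survive
    writes to the scratch register, since both the test and the increment overwrite [u]. *)
Lemma loop_within P w b i nb u body n T (I : nat -> (nat -> nat) -> Prop) r :
  i != u -> nb != u ->
  code_at P b (loop_code b i nb u body) ->
  (forall k r, I k r -> r i = k /\ r nb = n) ->
  (forall k r v, I k r -> I k (set_reg r u v)) ->
  (forall k r, k < n -> I k r -> exists r',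
     [/\ within P w T (Config (b + 2) r) (Config (b + 2 + size body) r'),
         r' i = k & forall v, I k.+1 (set_reg (set_reg r' u v) i k.+1)]) ->
  I 0 r -> exists r',
  within P w (n * (T + 5) + 2) (Config b r) (Config (b + (size body + 5)) r') /\ I n r'.
Proof.
move=> iu nbu /code_at_cat[/code_at_cons[c1 /code_at_cons[c2 _]] /code_at_cat[cb]].
move=> /code_at_cons[c3 /code_at_cons[c4 /code_at_cons[c5 _]]].
move=> Ir Iu Ib I0.
(* Induction on the number [m] of remaining iterations. *)
suff main : forall m r, m <= n -> I (n - m) r -> exists r',
    within P w (m * (T + 5) + 2) (Config b r) (Config (b + (size body + 5)) r') /\ I n r'.
  by apply: main; rewrite ?subnn.
move=> {r I0}; elim=> [|m IH] r mn Hr.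
  have [ri rn] := Ir _ _ Hr; rewrite subn0 in Hr ri *.
  exists (set_reg r u 0); split; last exact: Iu.
  apply: within_step c1 _; rewrite /= ri rn subnn.
  apply: within_step c2 _; rewrite /= /set_reg eqxx; exact: within_refl.
have [ri rn] := Ir _ _ Hr.
have [|r' [Hw r'i Hr']] := Ib _ _ _ (Iu _ _ m.+1 Hr); first by lia.
have [|r'' [Hw' Hr'']] := IH (set_reg (set_reg r' u 1) i (n - m.+1).+1) (ltnW mn).
  by have -> : n - m = (n - m.+1).+1 by lia.
exists r''; split=> //.
(* Two steps for the test, [T] for the body, three for the increment and the jump back, then the
   remaining iterations. *)
have -> : m.+1 * (T + 5) + 2 = 2 + (T + (3 + (m * (T + 5) + 2))) by lia.
apply: (@within_trans _ _ 2 _ _ (Config (b + 2) (set_reg r u m.+1))).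
  apply: within_step c1 _; rewrite /= ri rn.
  have -> : n - (n - m.+1) = m.+1 by lia.
  apply: within_step c2 _; rewrite /= /set_reg eqxx addn2; exact: within_refl.
apply: within_trans Hw _.
apply: within_trans Hw'.
apply: within_step c3 _ => /=.
apply: within_step c4 _ => /=.
apply: within_step c5 _ => /=.
have -> : set_reg r' u 1 i + set_reg r' u 1 u = (n - m.+1).+1.
  by rewrite /set_reg eqxx (negbTE iu) r'i addn1.
exact: within_refl.
Qed.

Lemma cell_code_within P w b a i u k r :
  i != u -> r i = k -> code_at P b (cell_code a i u) ->
  exists r', [/\ within P w 4 (Config b r) (Config (b + 4) r'),
    r' i = cell a k & forall j, j != i -> j != u -> r' j = r j].
Proof.
move=> iu ri /code_at_cons[c1 /code_at_cons[c2 /code_at_cons[c3 /code_at_cons[c4 _]]]].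
eexists; split.
- do 4! (apply: within_step; first by eassumption).
  by rewrite addn4; apply: within_refl.
- rewrite /= /set_reg !eqxx (negbTE iu) ri /cell; lia.
- by move=> j ji ju; rewrite /= /set_reg (negbTE ji) (negbTE ju).
Qed.

Lemma cexp_within P w B st e sg rho d b r :
  represents sg d st rho r -> (forall x, rho x <= B) ->
  code_at P b (cexp sg d b e) ->
  exists r', [/\ within P w (etime B e) (Config b r)
                   (Config (b + size (cexp sg d b e)) r'),
                 r' (temp d) = eval w st rho e & frame d r r'].
Proof.
elim: e sg rho d b r => [v|x|e1 IH1 e2 IH2|e1 IH1 e2 IH2|e IH|a e IH|x lim e IH]
  sg rho d b r Hr HB /=.
- move=> /code_at_cons[c1 _]; eexists; split.
  + by apply: within_step c1 _; rewrite addn1; apply: within_refl.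
  + by rewrite /= /set_reg eqxx.
  + by apply: frame_set => //; apply: frame_refl.
- move=> /code_at_cons[c1 /code_at_cons[c2 _]]; eexists; split.
  + apply: within_step c1 _; apply: within_step c2 _.
    by rewrite addn2; apply: within_refl.
  + case: Hr => h1 h2 _.
    by rewrite /= /set_reg eqxx temp_inj (ltn_eqF (h1 x)) h2.
  + by do 2! apply: frame_set => //; apply: frame_refl.
- move=> /code_at_cat[c1 /code_at_cat[c2 /code_at_cons[c3 _]]].
  have [r1 [w1 v1 f1]] := IH1 _ _ _ _ _ Hr HB c1.
  have Hr1 := represents_le (leqnSn d) (represents_frame f1 Hr).
  have [r2 [w2 v2 f2]] := IH2 _ _ _ _ _ Hr1 HB c2.
  eexists; split.
  + rewrite !size_cat; apply: within_trans w1 _.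
    rewrite addnA; apply: within_trans w2 _.
    by apply: within_step c3 _; rewrite !addnA addn1; apply: within_refl.
  + rewrite /= /set_reg eqxx v2; case: f2 => -> // _; by rewrite v1.
  + apply: frame_set => //; apply: frame_trans f1 _.
    exact: frame_le (leqnSn d) f2.
- move=> /code_at_cat[c1 /code_at_cat[c2 /code_at_cons[c3 _]]].
  have [r1 [w1 v1 f1]] := IH1 _ _ _ _ _ Hr HB c1.
  have Hr1 := represents_le (leqnSn d) (represents_frame f1 Hr).
  have [r2 [w2 v2 f2]] := IH2 _ _ _ _ _ Hr1 HB c2.
  eexists; split.
  + rewrite !size_cat; apply: within_trans w1 _.
    rewrite addnA; apply: within_trans w2 _.
    by apply: within_step c3 _; rewrite !addnA addn1; apply: within_refl.
  + rewrite /= /set_reg eqxx v2; case: f2 => -> // _; by rewrite v1.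
  + apply: frame_set => //; apply: frame_trans f1 _.
    exact: frame_le (leqnSn d) f2.
- move=> /code_at_cat[c1 /code_at_cons[c2 _]].
  have [r1 [w1 v1 f1]] := IH _ _ _ _ _ Hr HB c1.
  eexists; split.
  + rewrite size_cat; apply: within_trans w1 _.
    by apply: within_step c2 _; rewrite addnA addn1; apply: within_refl.
  + by rewrite /= /set_reg eqxx v1.
  + exact: frame_set.
- move=> /code_at_cat[c1 cT].
  have [c2 /code_at_cons[c3 _]] :=
    code_at_cat (C1 := cell_code a (temp d) (temp d.+1)) cT.
  have [r1 [w1 v1 f1]] := IH _ _ _ _ _ Hr HB c1.
  have ne : temp d != temp d.+1 by rewrite temp_inj neq_ltn ltnSn.
  have [r2 [w2 v2 f2]] := cell_code_within w ne v1 c2.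
  have F2 : frame d r1 r2.
    split=> [j jd|a' i]; apply: f2; rewrite ?cell_temp // temp_inj neq_ltn ?jd //.
    by rewrite ltnW.
  eexists; split.
  + rewrite size_cat; apply: within_trans w1 _.
    apply: (@within_trans _ _ 4 1 _ _ _ w2).
    by apply: within_step c3 _; apply: within_at => /=; lia.
  + rewrite /= /set_reg eqxx v2.
    by have [_ _ <-] := represents_frame (frame_trans f1 F2) Hr.
  + by apply: frame_set => //; apply: frame_trans F2.
move=> /code_at_cons[c1 /code_at_cons[c2 cl]].
rewrite -addn2 in cl.
pose body := cexp (set_reg sg x d.+1) d.+2 (b + 4) e
            ++ [:: Iadd (temp d) (temp d) (temp d.+2)].
pose S k := \sum_(0 <= j < k) eval w st (set_reg rho x j) e.
(* The accumulator holds the partial sum, and the next temporary the summation index. *)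
pose I k r' := [/\ r' (temp d) = S k, r' (temp d.+1) = k & frame d r r'].
have [||||||r' [w' [v' _ f']]] := @loop_within P w (b + 2) (temp d.+1)
    (temp (sg lim)) (temp d.+2) body (rho lim) (etime B e + 1) I
    (set_reg (set_reg r (temp d) 0) (temp d.+1) 0) _ _ cl.
- rewrite temp_inj; lia.
- case: Hr => /(_ lim); rewrite temp_inj; lia.
- move=> k r1 [_ -> f]; split=> //.
  by have [_ -> _] := represents_frame f Hr.
- move=> k r1 v [h1 h2 h3]; split; last (by apply: frame_set => //; lia).
  + by rewrite /set_reg ifF // temp_inj; lia.
  + by rewrite /set_reg ifF // temp_inj; lia.
- move=> k r1 kn [h1 h2 h3].
  have Hr1 := represents_frame h3 Hr.
  have := represents_bind x (represents_le (leqnSn d) Hr1).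
  rewrite h2 => Hr2.
  have [_ /code_at_cat[cb _]] := code_at_cat (C1 := [:: _; _]) cl.
  move/code_at_cat: cb => [cb1 /code_at_cons[cb2 _]].
  have HB2 y : set_reg rho x k y <= B.
    rewrite /set_reg; case: ifP => // _; apply: leq_trans (HB lim); exact: ltnW.
  rewrite -addnA in cb1 cb2.
  have [r2 [w2 v2 f2]] := IH _ _ _ _ _ Hr2 HB2 cb1.
  eexists; split.
  + rewrite -!addnA; apply: within_trans w2 _.
    apply: within_step cb2 _.
    by rewrite /= size_cat !addnA addn1; apply: within_refl.
  + rewrite /= /set_reg ifF; last by rewrite temp_inj; lia.
    by case: f2 => -> // _.
  + move=> v; split.
    * rewrite /= /set_reg !temp_inj eqxx v2.
      rewrite !ifF; try lia.
      case: f2 => -> // _; rewrite h1 /S big_nat_recr //=.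
    * by rewrite /= /set_reg eqxx.
    * do 3 (apply: frame_set; first lia).
      apply: frame_trans h3 _; apply: frame_le f2; lia.
- split.
  + by rewrite /set_reg temp_inj eqxx ifF /S ?big_geq //; lia.
  + by rewrite /set_reg eqxx.
  + by do 2! (apply: frame_set; first lia); apply: frame_refl.
exists r'; split=> //.
set z := (X in b + X).
have -> : z = 2 + (size body + 5) by rewrite /z /body !size_cat /=; lia.
rewrite [b + (2 + _)]addnA.
apply: (@within_trans _ _ 2 (B * (etime B e + 1 + 5) + 2) _
  (Config (b + 2) (set_reg (set_reg r (temp d) 0) (temp d.+1) 0))).
  apply: within_step c1 _; apply: within_step c2 _.
  by rewrite addn2; apply: within_refl.
apply: within_le _ w'; by rewrite leq_add2r leq_mul2r HB orbT.
Qed.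

(* The values named by [Let] bound the number of iterations of loops. *)
Fixpoint cmd_ok (w : seq nat) (B : nat) (rho : nat -> nat) (c : cmd) : Prop :=
  match c with
  | Let x e c => forall st, eval w st rho e <= B /\
      cmd_ok w B (set_reg rho x (eval w st rho e)) c
  | Put _ _ _ => True
  | For x lim c => forall k, k < rho lim -> cmd_ok w B (set_reg rho x k) c
  | Seq c1 c2 => cmd_ok w B rho c1 /\ cmd_ok w B rho c2
  end.

Lemma ccmd_within P w B c sg st rho d b r :
  represents sg d st rho r -> (forall x, rho x <= B) -> cmd_ok w B rho c ->
  code_at P b (ccmd sg d b c) ->
  exists r', [/\ within P w (ctime B c) (Config b r)
                   (Config (b + size (ccmd sg d b c)) r'),
                 forall j, j < d -> r' (temp j) = r (temp j)
               & forall a i, r' (cell a i) = run_cmd w st rho c a i].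
Proof.
elim: c sg st rho d b r => [x e c IH|a i e|x lim c IH|c1 IH1 c2 IH2]
  sg st rho d b r Hr HB /= ok.
- move=> /code_at_cat[C1 C2].
  have [r1 [w1 v1 f1]] := cexp_within w Hr HB C1.
  have := represents_bind x (represents_frame f1 Hr); rewrite v1 => Hr1.
  have [e_le ok1] := ok st.
  have [|r2 [w2 v2 f2]] := IH _ _ _ _ _ _ Hr1 _ ok1 C2.
    by move=> y; rewrite /set_reg; case: ifP.
  exists r2; split=> //.
  + by rewrite size_cat addnA; apply: within_trans w1 w2.
  + by move=> j jd; rewrite v2 ?leqW //; case: f1 => -> .
- move=> /code_at_cat[c1 /code_at_cat[c2 cT]].
  have [c3 /code_at_cons[c4 _]] :=
    code_at_cat (C1 := cell_code a (temp d) (temp d.+2)) cT.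
  have [r1 [w1 v1 f1]] := cexp_within w Hr HB c1.
  have Hr1 := represents_le (leqnSn d) (represents_frame f1 Hr).
  have [r2 [w2 v2 f2]] := cexp_within w Hr1 HB c2.
  have ne : temp d != temp d.+2 by rewrite temp_inj; lia.
  have v1' : r2 (temp d) = eval w st rho i by case: f2 => -> // _.
  have [r3 [w3 v3 f3]] := cell_code_within w ne v1' c3.
  eexists; split.
  + rewrite !size_cat; apply: within_trans w1 _.
    rewrite addnA; apply: within_trans w2 _.
    apply: (@within_trans _ _ 4 1 _ _ _ w3).
    by apply: within_step c4 _; apply: within_at => /=; lia.
  + move=> j jd; rewrite /= /set_reg v3 temp_cell f3 ?temp_inj; try lia.
    by case: f2 => -> //; [case: f1 => ->|apply: leqW].
  + move=> a' k; rewrite /= /set_reg v3 cell_inj /set_store.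
    case: eqP => [->|_] /=.
      rewrite /set_reg; case: eqP => _.
        by rewrite f3 ?temp_inj //; lia.
      rewrite f3 ?cell_temp //.
      by have [_ _ ->] := represents_frame f2 Hr1.
    rewrite f3 ?cell_temp //.
    by have [_ _ ->] := represents_frame f2 Hr1.
- move=> /code_at_cons[c1 cl].
  pose body := ccmd (set_reg sg x d) d.+1 (b + 3) c.
  pose F := foldl (fun st k => run_cmd w st (set_reg rho x k) c) st.
  (* The cells hold the store after the first [k] iterations. *)
  pose I k r' := [/\ r' (temp d) = k, forall j, j < d -> r' (temp j) = r (temp j)
    & forall a i, r' (cell a i) = F (iota 0 k) a i].
  have [h1 h2 h3] := Hr.
  have [||||||r' [w' [_ f' v']]] := @loop_within P w b.+1 (temp d)
    (temp (sg lim)) (temp d.+1) body (rho lim) (ctime B c) I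
    (set_reg r (temp d) 0) _ _ cl.
  + rewrite temp_inj; lia.
  + have := h1 lim; rewrite temp_inj; lia.
  + by move=> k r1 [-> H _]; split=> //; rewrite H.
  + move=> k r1 v [H1 H2 H3]; split=> [|j jd|a i]; rewrite /set_reg ?cell_temp //.
      by rewrite temp_inj ifF //; lia.
    by rewrite temp_inj ifF ?H2 //; lia.
  + move=> k r1 kn [H1 H2 H3].
    have Hr1 : represents sg d (F (iota 0 k)) rho r1.
      by split=> // y; rewrite H2.
    have := represents_bind x Hr1; rewrite H1 => Hr2.
    have HB2 y : set_reg rho x k y <= B.
      rewrite /set_reg; case: ifP => // _; apply: leq_trans (HB lim); exact: ltnW.
    have [_ /code_at_cat[cb _]] := code_at_cat (C1 := [:: _; _]) cl.
    rewrite addSnnS in cb *.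
    have [r2 [w2 v2 f2]] := IH _ _ _ _ _ _ Hr2 HB2 (ok _ kn) cb.
    exists r2; split=> //; first by rewrite v2.
    move=> v; split=> [|j jd|a i]; rewrite /set_reg ?eqxx ?cell_temp //.
      by rewrite !temp_inj !ifF ?v2 ?H2 //; lia.
    by rewrite f2 -addn1 iotaD /F foldl_cat.
  + split=> [|j jd|a i]; rewrite /set_reg ?eqxx ?cell_temp //.
    by rewrite temp_inj ifF //; lia.
  exists r'; split=> //.
  set z := (X in b + X).
  have -> : z = 1 + (size body + 5) by rewrite /z /body !size_cat /=; lia.
  rewrite [b + (1 + _)]addnA addn1.
  apply: (@within_trans _ _ 1 (B * (ctime B c + 5) + 2) _
    (Config b.+1 (set_reg r (temp d) 0))).
    by apply: within_step c1 _; apply: within_refl.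
  apply: within_le _ w'.
  by rewrite leq_add2r leq_mul2r HB orbT.
- move=> /code_at_cat[C1 C2]; case: ok => ok1 ok2.
  have [r1 [w1 v1 f1]] := IH1 _ _ _ _ _ _ Hr HB ok1 C1.
  have Hr1 : represents sg d (run_cmd w st rho c1) rho r1.
    by case: Hr => h1 h2 h3; split=> // x; rewrite v1.
  have [r2 [w2 v2 f2]] := IH2 _ _ _ _ _ _ Hr1 HB ok2 C2.
  exists r2; split=> //.
  + by rewrite size_cat addnA; apply: within_trans w1 w2.
  + by move=> j jd; rewrite v2 // v1.
Qed.

Lemma cmd_polytime (X : Type) (enc : X -> seq nat) (dom Q : X -> Prop)
    (c : cmd) (a : 'I_3) :
  (forall x, dom x -> cmd_ok (enc x) (input_size (enc x)) (fun=> 0) c /\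
     (run_cmd (enc x) (fun _ _ => 0) (fun=> 0) c a 0 != 0 <-> Q x)) ->
  polytime_decidable enc dom Q.
Proof.
move=> H.
(* Every name starts out in temporary 0, which holds 0, so allocation begins at depth 1; the zero
   registers represent the zero store. *)
set C := ccmd (fun=> 0) 1 0 c.
have [p hp] := ctime_poly c.
(* The two final instructions copy the answer to register 0 and account for the added constant. *)
exists (C ++ [:: Iconst 0 0; Iadd 0 0 (cell a 0)]), (p + 2%:P)%R => x /H[ok HQ].
set P := C ++ _; set w := enc x; set B := input_size w.
have atP : code_at P 0 P by [].
have [c1 /code_at_cons[c2 /code_at_cons[c3 _]]] := code_at_cat atP.
have [||r [wr _ vr]] := @ccmd_within P w B c (fun=> 0) (fun _ _ => 0) (fun=> 0)
  1 0 (fun=> 0) _ _ ok c1.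
- by split.
- by [].
have WP : within P w (p + 2%:P).[B]%R (Config 0 (fun=> 0))
    (Config (size P) (set_reg (set_reg r 0 0) 0 (r (cell a 0)))).
  rewrite hornerD hornerC hp; apply: within_trans wr _.
  apply: within_step c2 _; apply: within_step c3 _.
  by rewrite size_cat /= addn2; apply: within_refl.
have hP : halted P (Config (size P) (set_reg (set_reg r 0 0) 0 (r (cell a 0)))).
  by rewrite /halted.
rewrite /config_after (within_halted WP hP) /=; split=> //.
by rewrite /set_reg eqxx vr.
Qed.

(** * The decision procedure *)

(* Expressions are used as truth values, nonzero meaning true. *)
Definition holds w st rho e := eval w st rho e != 0.

Definition Not e := Minus (Cst 1) e.
Definition And e1 e2 := Not (Plus (Not e1) (Not e2)).

Lemma holds_not w st rho e : holds w st rho (Not e) = ~~ holds w st rho e.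
Proof. rewrite /holds /=; lia. Qed.

Lemma holds_or w st rho e1 e2 :
  holds w st rho (Plus e1 e2) = holds w st rho e1 || holds w st rho e2.
Proof. rewrite /holds /=; lia. Qed.

Lemma holds_and w st rho e1 e2 :
  holds w st rho (And e1 e2) = holds w st rho e1 && holds w st rho e2.
Proof. by rewrite holds_not holds_or !holds_not negb_or !negbK. Qed.

(** A sum of naturals is nonzero exactly when some summand is, so [Sum] serves as a bounded
    existential quantifier. *)
Lemma holds_sum w st rho x b e n : rho b = n ->
  holds w st rho (Sum x b e) = [exists k : 'I_n, holds w st (set_reg rho x k) e].
Proof.
move=> <-; rewrite /holds /= big_mkord sum_nat_eq0 negb_forall.
by apply: eq_existsb => k; rewrite implyTb.
Qed.

(* Names for the numbers of states and of propositions, the length of the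
   execution, the number of states plus one, the offsets of the labels, effect,
   cause and execution in the input, the initial state, the objective, and the
   loop variables; [vD] is the dummy variable of products. *)
Notation vN := 1 (only parsing).
Notation vA := 2 (only parsing).
Notation vM := 3 (only parsing).
Notation vN1 := 4 (only parsing).
Notation vOL := 5 (only parsing).
Notation vOE := 6 (only parsing).
Notation vOC := 7 (only parsing).
Notation vOX := 8 (only parsing).
Notation vI := 9 (only parsing).
Notation vO := 10 (only parsing).
Notation vK := 11 (only parsing).
Notation vS := 12 (only parsing).
Notation vT := 13 (only parsing).
Notation vL := 14 (only parsing).
Notation vD := 15 (only parsing).

Lemma eval_mul w st rho b e v : (forall k, eval w st (set_reg rho vD k) e = v) ->
  eval w st rho (Sum vD b e) = rho b * v.
Proof.
move=> H /=; under eq_bigr do rewrite H.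
by rewrite sum_nat_const_nat subn0.
Qed.

Lemma nth_allpairs_enum n k (f : 'I_n -> 'I_k -> nat) (i : 'I_n) (j : 'I_k) :
  nth 0 [seq f s t | s <- enum 'I_n, t <- enum 'I_k] (i * k + j) = f i j.
Proof.
have H (s : seq 'I_n) l : l < size s ->
    nth 0 [seq f s t | s <- s, t <- enum 'I_k] (l * k + j) = f (nth i s l) j.
  elim: s l => //= a s IH [|l] Hl; rewrite nth_cat size_map size_enum_ord.
    by rewrite mul0n add0n ltn_ord (nth_map j) ?size_enum_ord ?nth_ord_enum.
  rewrite ifF; last by rewrite mulSn; lia.
  by rewrite -IH //; congr nth; rewrite mulSn; lia.
by rewrite H ?size_enum_ord // nth_ord_enum.
Qed.

(** * Reading an encoded instance *)

Section Encoding.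
Variable x : cf_data.
Let w := encode x.
Let n := nstates x.
Let na := nprops x.
Let m := size (execution x).
Let o : nat := if obj x is Reach then 0 else 1.
(** Offsets of the blocks, after a header of four numbers; [oX] also skips the length of the
    execution, stored at [oC + n]. *)
Let oL := 4 + n * n.
Let oE := oL + n * na.
Let oC := oE + n.
Let oX := oC + n + 1.

Lemma size_encode : size w = oX + m.
Proof.
rewrite /w /encode !size_cat !size_allpairs !(size_enum_ord, size_map) /= size_map.
rewrite /oX /oC /oE /oL; lia.
Qed.

Lemma nth_encode_trans (i j : 'I_n) : nth 0 w (4 + (i * n + j)) = trans (ts x) i j.
Proof.
rewrite /w /encode [LHS]/= nth_cat size_allpairs !size_enum_ord nth_allpairs_enum ifT //.
have := ltn_ord i; have := ltn_ord j; nia.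
Qed.

Lemma nth_encode_label (i : 'I_n) (a : 'I_na) :
  nth 0 w (oL + (i * na + a)) = (a \in label (ts x) i).
Proof.
rewrite /w /encode /oL [LHS]/=.
rewrite nth_cat size_allpairs !size_enum_ord ifF; last by rewrite /n; lia.
have -> : n * n + (i * na + a) - nstates x * nstates x = i * na + a.
  by rewrite /n; lia.
rewrite nth_cat size_allpairs !size_enum_ord nth_allpairs_enum ifT //.
have := ltn_ord i; have := ltn_ord a; nia.
Qed.

Lemma drop_oE : drop oE w =
  [seq nat_of_bool (s \in effect x) | s <- enum 'I_n]
  ++ [seq nat_of_bool (s \in cause x) | s <- enum 'I_n]
  ++ size (execution x) :: [seq nat_of_ord s | s <- execution x].
Proof.
rewrite /w /encode /oE /oL -!addnA [LHS]/= catA drop_size_cat //.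
by rewrite size_cat !size_allpairs !size_enum_ord.
Qed.

Lemma nth_encode_effect (i : 'I_n) : nth 0 w (oE + i) = (i \in effect x).
Proof.
rewrite -nth_drop drop_oE nth_cat size_map size_enum_ord ltn_ord.
by rewrite (nth_map i) ?size_enum_ord // nth_ord_enum.
Qed.

Lemma nth_encode_cause (i : 'I_n) : nth 0 w (oC + i) = (i \in cause x).
Proof.
rewrite /oC -addnA -nth_drop drop_oE nth_cat size_map size_enum_ord ifF; last by lia.
rewrite addKn nth_cat size_map size_enum_ord ltn_ord.
by rewrite (nth_map i) ?size_enum_ord // nth_ord_enum.
Qed.

Lemma nth_encode_execution i0 k : k < m -> nth 0 w (oX + k) = nth i0 (execution x) k.
Proof.
move=> km; have -> : oX + k = oE + (n + n + k.+1) by rewrite /oX /oC; lia.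
rewrite -nth_drop drop_oE catA nth_cat.
rewrite size_cat !(size_enum_ord, size_map) ifF /n; last by lia.
rewrite (_ : _ - _ = k.+1) /=; last by lia.
by rewrite (nth_map i0).
Qed.

Lemma nth_encode_size : nth 0 w (oC + n) = m.
Proof.
have -> : oC + n = oE + (n + n) by rewrite /oC addnA.
rewrite -nth_drop drop_oE catA nth_cat.
rewrite size_cat !(size_enum_ord, size_map) ifF /n; last by lia.
by rewrite subnn.
Qed.

(** Every number counts for at least one bit. Loop bounds are therefore only compared with the
    length of the encoding. *)
Lemma size_le_input_size (s : seq nat) : size s <= input_size s.
Proof.
rewrite /input_size -sum1_size; exact: leq_sum.
Qed.

(** These names are all smaller than [vK], so binding loop variables preserves them. *)
Record env (rho : nat -> nat) : Prop := Env {
  envN : rho vN = n; envA : rho vA = na; envM : rho vM = m; envN1 : rho vN1 = n.+1;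
  envOL : rho vOL = oL; envOE : rho vOE = oE; envOC : rho vOC = oC;
  envOX : rho vOX = oX; envI : rho vI = init (ts x); envO : rho vO = o }.

Lemma env_bind rho y v : vK <= y -> env rho -> env (set_reg rho y v).
Proof.
move=> h [*]; split; rewrite /set_reg ifF //; apply/eqP; lia.
Qed.

Definition setup (c : cmd) : cmd :=
  Let vN (Inp (Cst 0)) (Let vA (Inp (Cst 1)) (Let vI (Inp (Cst 2))
  (Let vO (Inp (Cst 3)) (Let vN1 (Plus (Nm vN) (Cst 1))
  (Let vOL (Plus (Cst 4) (Sum vD vN (Nm vN)))
  (Let vOE (Plus (Nm vOL) (Sum vD vN (Nm vA)))
  (Let vOC (Plus (Nm vOE) (Nm vN))
  (Let vOX (Plus (Plus (Nm vOC) (Nm vN)) (Cst 1))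
  (Let vM (Inp (Plus (Nm vOC) (Nm vN))) c))))))))).

Definition setup_env : nat -> nat :=
  set_reg (set_reg (set_reg (set_reg (set_reg (set_reg (set_reg (set_reg (set_reg
    (set_reg (fun=> 0) vN n) vA na) vI (init (ts x))) vO o) vN1 n.+1)
    vOL oL) vOE oE) vOC oC) vOX oX) vM m.

Lemma env_setup : env setup_env.
Proof. by []. Qed.

Lemma run_let st rho y e v c : eval w st rho e = v ->
  run_cmd w st rho (Let y e c) = run_cmd w st (set_reg rho y v) c.
Proof. by move=> <-. Qed.

Lemma cmd_ok_let B rho y e v c : (forall st, eval w st rho e = v) -> v <= B ->
  cmd_ok w B (set_reg rho y v) c -> cmd_ok w B rho (Let y e c).
Proof. by move=> H hv hc st /=; rewrite H. Qed.

Lemma run_setup st c : run_cmd w st (fun=> 0) (setup c) = run_cmd w st setup_env c.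
Proof.
rewrite /setup (@run_let _ _ _ _ n) // (@run_let _ _ _ _ na) //.
rewrite (@run_let _ _ _ _ (init (ts x))) // (@run_let _ _ _ _ o) //.
rewrite (@run_let _ _ _ _ n.+1); last by rewrite /= addn1.
rewrite (@run_let _ _ _ _ oL); last first.
  by rewrite [LHS]/= -/(eval w st _ (Sum vD vN (Nm vN))) (@eval_mul _ _ _ _ _ n).
rewrite (@run_let _ _ _ _ oE); last first.
  by rewrite [LHS]/= -/(eval w st _ (Sum vD vN (Nm vA))) (@eval_mul _ _ _ _ _ na).
rewrite (@run_let _ _ _ _ oC) // (@run_let _ _ _ _ oX) //.
by rewrite (@run_let _ _ _ _ m) // -nth_encode_size.
Qed.

Lemma cmd_ok_setup c : cmd_ok w (input_size w) setup_env c ->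
  cmd_ok w (input_size w) (fun=> 0) (setup c).
Proof.
move=> H.
have le_size v : v <= size w -> v <= input_size w.
  by move=> h; apply: leq_trans h (size_le_input_size w).
(* There is an initial state, so [na <= n * na], which the size of the label table bounds. *)
have n_gt0 : 0 < n by apply: leq_trans (ltn_ord (init (ts x))).
apply: (@cmd_ok_let _ _ _ _ n) => //.
  by apply: le_size; rewrite size_encode /oX; lia.
apply: (@cmd_ok_let _ _ _ _ na) => //.
  by apply: le_size; rewrite size_encode /oX /oC /oE; nia.
apply: (@cmd_ok_let _ _ _ _ (init (ts x))) => //.
  apply: le_size; rewrite size_encode /oX; have := ltn_ord (init (ts x)); lia.
apply: (@cmd_ok_let _ _ _ _ o) => //.
  by apply: le_size; rewrite size_encode /oX /o; case: (obj x); lia.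
apply: (@cmd_ok_let _ _ _ _ n.+1) => [st||]; first by rewrite /= addn1.
  by apply: le_size; rewrite size_encode /oX; lia.
apply: (@cmd_ok_let _ _ _ _ oL) => [st||].
- by rewrite [LHS]/= -/(eval w st _ (Sum vD vN (Nm vN))) (@eval_mul _ _ _ _ _ n).
- by apply: le_size; rewrite size_encode /oX /oC /oE; lia.
apply: (@cmd_ok_let _ _ _ _ oE) => [st||].
- by rewrite [LHS]/= -/(eval w st _ (Sum vD vN (Nm vA))) (@eval_mul _ _ _ _ _ na).
- by apply: le_size; rewrite size_encode /oX /oC; lia.
apply: (@cmd_ok_let _ _ _ _ oC) => //.
  by apply: le_size; rewrite size_encode /oX; lia.
apply: (@cmd_ok_let _ _ _ _ oX) => //.
  by apply: le_size; rewrite size_encode; lia.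
apply: (@cmd_ok_let _ _ _ _ m) => // [st|]; first by rewrite -nth_encode_size.
by apply: le_size; rewrite size_encode; lia.
Qed.

(** * Tables filled row by row *)

Lemma foldl_iota_ind (T : Type) (f : T -> nat -> T) (I : nat -> T -> Prop) l z :
  I 0 z -> (forall k z, k < l -> I k z -> I k.+1 (f z k)) ->
  I l (foldl f z (iota 0 l)).
Proof.
move=> I0; elim: l => [//|l IH] Hf.
have {IH} Il : I l (foldl f z (iota 0 l)) by apply: IH => k y kl; apply/Hf/ltnW.
by rewrite -{2}addn1 iotaD foldl_cat; apply: Hf.
Qed.

(** Uniqueness of quotient and remainder by [n]; hence writing one entry leaves all others
    intact. *)
Lemma row_major_inj k k' (s s' : 'I_n) :
  (k * n + s == k' * n + s') = (k == k') && (s == s').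
Proof.
apply/eqP/andP => [H|[/eqP -> /eqP ->] //].
have := congr1 (divn^~ n) H; have := congr1 (modn^~ n) H.
have n0 : 0 < n by apply: leq_ltn_trans (ltn_ord s).
rewrite !modnMDl !modn_small // !divnMDl // !divn_small // !addn0 => hs ->.
by split=> //; apply/eqP/val_inj.
Qed.

(* [Sum vD vN (Nm k)] is the product of the number of states and [k]. *)
Definition row_index (k s : nat) := Plus (Sum vD vN (Nm k)) (Nm s).

Lemma eval_row_index st rho k s : env rho -> k != vD ->
  eval w st rho (row_index k s) = rho k * n + rho s.
Proof.
move=> Hr kD; rewrite [LHS]/= -/(eval w st rho (Sum vD vN (Nm k))).
rewrite (@eval_mul _ _ _ _ _ (rho k)) ?(envN Hr) 1?mulnC //.
by move=> j; rewrite /= /set_reg (negbTE kD).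
Qed.

Definition table a lim e :=
  For vK lim (For vS vN (Put a (row_index vK vS) e)).

(** The hypothesis on [e] lets row [k] be computed from the preceding row of the same table and from
    the other tables. The invariant [I] covers completed rows, [J] also the completed entries of the
    current row. *)
Lemma run_table st rho a lim e (G : nat -> {set 'I_n}) : env rho ->
  (forall st' k (s : 'I_n), k < rho lim -> (forall a', a' != a -> st' a' = st a') ->
     (forall k', k = k'.+1 ->
        forall t : 'I_n, (st' a (k' * n + t) != 0) = (t \in G k')) ->
     holds w st' (set_reg (set_reg rho vK k) vS s) e = (s \in G k)) ->
  let st' := run_cmd w st rho (table a lim e) in
  (forall a', a' != a -> st' a' = st a') /\
  (forall k (s : 'I_n), k < rho lim -> (st' a (k * n + s) != 0) = (s \in G k)).
Proof.
move=> Hr He; rewrite /table.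
pose I k (st' : store) := (forall a', a' != a -> st' a' = st a') /\
  (forall k' (s : 'I_n), k' < k -> (st' a (k' * n + s) != 0) = (s \in G k')).
apply: (@foldl_iota_ind _ _ I) => // k st1 kl [H1 H2].
pose J j (st' : store) := I k st' /\
  (forall s : 'I_n, s < j -> (st' a (k * n + s) != 0) = (s \in G k)).
have : J n (run_cmd w st1 (set_reg rho vK k) (For vS vN (Put a (row_index vK vS) e))).
  rewrite [run_cmd _ _ _ _]/= [set_reg _ _ _ vN](envN Hr).
  apply: foldl_iota_ind => // j st2 jn [[H3 H4] H5].
  have Hr' : env (set_reg (set_reg rho vK k) vS j) by do 2! apply: env_bind => //.
  move: (eval_row_index st2 vS Hr' (isT : vK != vD)) => /= ->.
  have := He st2 k (Ordinal jn) kl H3; rewrite /holds /= => He'.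
  rewrite /set_store; split; [split|].
  - by move=> a' ne; rewrite (negbTE ne) H3.
  - move=> k' s k'k; rewrite eqxx {1}/set_reg.
    rewrite (row_major_inj k' k s (Ordinal jn)) (ltn_eqF k'k) /=.
    exact: H4.
  - move=> s sj; rewrite eqxx {1}/set_reg.
    rewrite (row_major_inj k k s (Ordinal jn)) eqxx /=.
    case: (s =P Ordinal jn) => [->|ne].
      by rewrite He' // => k' kk'; move=> t; apply: H4; rewrite kk'.
    apply: H5; move: sj; rewrite ltnS leq_eqVlt => /orP[/eqP sj|//].
    by case: ne; apply: val_inj.
move=> [[H3 H4] H5]; split=> // k' s; rewrite ltnS leq_eqVlt => /orP[/eqP ->|].
  exact: H5.
exact: H4.
Qed.

Definition tG : 'I_3 := @Ordinal 3 0 isT.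
Definition tH : 'I_3 := @Ordinal 3 1 isT.
Definition tR : 'I_3 := @Ordinal 3 2 isT.

Definition eTrans s t := Inp (Plus (Cst 4) (row_index s t)).
Definition eEffect s := Inp (Plus (Nm vOE) (Nm s)).
Definition eCause s := Inp (Plus (Nm vOC) (Nm s)).
Definition eTerm s := Not (Sum vT vN (eTrans s vT)).
Definition eCell a k s := Tab a (row_index k s).
(* In row 0 the truncated subtraction reads an unspecified cell. *)
Definition ePrev a k s := Tab a (Minus (row_index k s) (Nm vN)).
Definition eNext a k s := Tab a (Plus (Nm vN) (row_index k s)).
Definition eEq e1 e2 := Not (Plus (Minus e1 e2) (Minus e2 e1)).
Definition eLabel e := Inp (Plus (Nm vOL) (Plus (Sum vD vA e) (Nm vL))).
Definition eMatch := Not (Sum vL vA (Not (eEq (eLabel (Nm vS))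
                                        (eLabel (Inp (Plus (Nm vOX) (Nm vK))))))).

(* Row [k] of the table holds the [k]-th iterate of [pre X Y] from [Z]. *)
Definition eFix a X Y Z :=
  Plus (And (Not (Nm vK)) Z)
    (And (Nm vK) (And X (Plus Y (Sum vT vN (And (eTrans vS vT) (ePrev a vK vT)))))).

Definition eG := eFix tG (Not (eCause vS)) (eTerm vS) (Cst 1).
(** As [vO] is 0 for [Reach] and 1 for [Avoid], it selects the constraint, the target and the
    starting set, empty or full, so that one expression computes either fixed point. *)
Definition eH := eFix tH (And (Not (eCause vS)) (Plus (Not (Nm vO)) (Not (eEffect vS))))
  (Plus (And (Nm vO) (eTerm vS)) (And (Not (Nm vO)) (eEffect vS))) (Nm vO).
Definition eR := And (Not (eCause vS)) (And eMatch
  (Plus (And (Not (Nm vK)) (eEq (Nm vS) (Nm vI)))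
    (And (Nm vK) (Sum vT vN (And (ePrev tR vK vT) (eTrans vT vS)))))).
(** Row [n] of [tG] and [tH] holds the fixed points. The difference of [vM] and [vK + 1] is nonzero
    exactly when [k + 1 < m]. *)
Definition eAnswer := And (eCell tG vN vI) (Not (Sum vK vM (And
  (Sum vS vN (And (eCell tR vK vS) (eCell tH vN vS)))
  (Not (And (Minus (Nm vM) (Plus (Nm vK) (Cst 1)))
     (Sum vS vN (And (eNext tR vK vS) (eCell tG vN vS)))))))).

Definition algorithm : cmd := setup
  (Seq (table tG vN1 eG) (Seq (table tH vN1 eH) (Seq (table tR vM eR)
    (Put tG (Cst 0) eAnswer)))).

Lemma holds_cell st rho a k s : env rho -> k != vD ->
  holds w st rho (eCell a k s) = (st a (rho k * n + rho s) != 0).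
Proof. by move=> Hr kD; rewrite /holds -(eval_row_index st s Hr kD). Qed.

Lemma holds_prev st rho a k s l : env rho -> k != vD -> rho k = l.+1 ->
  holds w st rho (ePrev a k s) = (st a (l * n + rho s) != 0).
Proof.
move=> Hr kD kl; move: (eval_row_index st s Hr kD); rewrite /holds /= => ->.
rewrite (envN Hr) kl.
by rewrite mulSn -addnA addKn.
Qed.

Lemma holds_next st rho a k s : env rho -> k != vD ->
  holds w st rho (eNext a k s) = (st a ((rho k).+1 * n + rho s) != 0).
Proof.
move=> Hr kD; move: (eval_row_index st s Hr kD); rewrite /holds /= => ->.
by rewrite (envN Hr) mulSn addnA.
Qed.

Lemma holds_eq st rho e1 e2 :
  holds w st rho (eEq e1 e2) = (eval w st rho e1 == eval w st rho e2).
Proof. rewrite /holds /=; lia. Qed.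

Lemma holds_trans st rho s t (i j : 'I_n) :
  env rho -> s != vD -> rho s = i -> rho t = j ->
  holds w st rho (eTrans s t) = trans (ts x) i j.
Proof.
move=> Hr sD si tj; rewrite /holds (_ : eval w st rho _ =
  nth 0 w (4 + eval w st rho (row_index s t))) // eval_row_index // si tj.
by rewrite nth_encode_trans eqb0 negbK.
Qed.

Lemma holds_effect st rho s (i : 'I_n) : env rho -> rho s = i ->
  holds w st rho (eEffect s) = (i \in effect x).
Proof.
by move=> Hr si; rewrite /holds /= (envOE Hr) si nth_encode_effect eqb0 negbK.
Qed.

Lemma holds_cause st rho s (i : 'I_n) : env rho -> rho s = i ->
  holds w st rho (eCause s) = (i \in cause x).
Proof.
by move=> Hr si; rewrite /holds /= (envOC Hr) si nth_encode_cause eqb0 negbK.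
Qed.

Lemma holds_term st rho s (i : 'I_n) : env rho -> s != vD -> s != vT -> rho s = i ->
  holds w st rho (eTerm s) = dead_end (ts x) i.
Proof.
move=> Hr sD sT si; rewrite holds_not (holds_sum _ _ _ _ (envN Hr)) negb_exists.
apply: eq_forallb => t; rewrite (@holds_trans _ _ _ _ i t) //.
  exact: env_bind.
by rewrite /set_reg (negbTE sT).
Qed.

(** The [n + 1] rows hold the iterates 0 to [n], and [n] is the number of states. *)
Lemma run_table_fix st rho a eX eY eZ (X Y Z : {set 'I_n}) : env rho ->
  (forall st' k (s : 'I_n), let rho' := set_reg (set_reg rho vK k) vS s in
    [/\ holds w st' rho' eX = (s \in X), holds w st' rho' eY = (s \in Y)
      & holds w st' rho' eZ = (s \in Z)]) ->
  let st' := run_cmd w st rho (table a vN1 (eFix a eX eY eZ)) in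
  (forall a', a' != a -> st' a' = st a') /\
  (forall s : 'I_n, (st' a (n * n + s) != 0) = (s \in iter #|'I_n| (pre (ts x) X Y) Z)).
Proof.
move=> Hr H.
have [|H1 H2] := @run_table st rho a vN1 (eFix a eX eY eZ)
  (fun k => iter k (pre (ts x) X Y) Z) Hr.
  move=> st' k s kl H1 H2; have [hX hY hZ] := H st' k s.
  set rho' := set_reg (set_reg rho vK k) vS s in hX hY hZ *.
  have Hr' : env rho' by do 2! apply: env_bind => //.
  have hK : holds w st' rho' (Nm vK) = (k != 0) by [].
  rewrite !(holds_or, holds_and, holds_not) hX hY hZ hK.
  rewrite (holds_sum _ _ _ _ (envN Hr')).
  case: k => [|k] in rho' H2 hX hY hZ Hr' hK kl *; first by rewrite orbF.
  rewrite /= inE; congr (_ && (_ || _)); apply: eq_existsb => t.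
  rewrite holds_and (@holds_trans _ _ _ _ s t) // ?(@holds_prev _ _ _ _ _ k) //.
  - by rewrite -(H2 k) //.
  - exact: env_bind.
  - exact: env_bind.
by split=> // s; rewrite card_ord; apply: H2; rewrite (envN1 Hr).
Qed.

(** * Correctness of the three tables and of the answer *)

Let good : {set 'I_n} := gfp (ts x) (~: cause x) (dead (ts x)).
Let good_effect : {set 'I_n} := good_obj (ts x) (cause x) (effect x) (obj x).
Let matched (k : nat) : {set 'I_n} := matching (ts x) (~: cause x) (execution x) k.

Lemma run_table_good st rho : env rho ->
  let st' := run_cmd w st rho (table tG vN1 eG) in
  (forall a', a' != tG -> st' a' = st a') /\
  (forall s : 'I_n, (st' tG (n * n + s) != 0) = (s \in good)).
Proof.
move=> Hr; apply: run_table_fix => // st' k s rho'.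
have Hr' : env rho' by do 2! apply: env_bind => //.
split; rewrite ?inE //; last by rewrite (@holds_term _ _ _ s).
by rewrite holds_not (@holds_cause _ _ _ s).
Qed.

Lemma run_table_good_obj st rho : env rho ->
  let st' := run_cmd w st rho (table tH vN1 eH) in
  (forall a', a' != tH -> st' a' = st a') /\
  (forall s : 'I_n, (st' tH (n * n + s) != 0) = (s \in good_effect)).
Proof.
move=> Hr; rewrite /good_effect /good_obj.
have hO st' rho' : env rho' -> holds w st' rho' (Nm vO) = (o != 0).
  by move=> Hr'; rewrite /holds /= (envO Hr').
have tab X Y Z := @run_table_fix st rho tH
  (And (Not (eCause vS)) (Plus (Not (Nm vO)) (Not (eEffect vS))))
  (Plus (And (Nm vO) (eTerm vS)) (And (Not (Nm vO)) (eEffect vS))) (Nm vO) X Y Z Hr.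
case E: (obj x); apply: tab => st' k s rho';
  (have Hr' : env rho' by do 2! apply: env_bind => //);
  rewrite !(holds_or, holds_and) (@holds_term _ _ _ s) // !holds_not hO //
    (@holds_cause _ _ _ s) // (@holds_effect _ _ _ s) // /o E !inE /=.
- by rewrite andbT.
- by rewrite orbF.
Qed.

Lemma holds_match st rho k (s : 'I_n) : env rho -> k < m -> rho vK = k -> rho vS = s ->
  holds w st rho eMatch =
    (label (ts x) s == label (ts x) (nth (init (ts x)) (execution x) k)).
Proof.
move=> Hr km rK rS; rewrite holds_not (holds_sum _ _ _ _ (envA Hr)) negb_exists.
set u := nth _ _ _.
have lab e (v : 'I_n) (a : 'I_na) :
    (forall j, eval w st (set_reg (set_reg rho vL a) vD j) e = v) ->
    eval w st (set_reg rho vL a) (eLabel e) = (a \in label (ts x) v).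
  move=> he; rewrite -nth_encode_label.
  rewrite (_ : eval _ _ _ _ =
    nth 0 w (rho vOL + (eval w st (set_reg rho vL a) (Sum vD vA e) + a))) //.
  by rewrite (eval_mul _ he) (envOL Hr) [set_reg _ _ _ vA](envA Hr) mulnC.
have hS (a : 'I_na) j : eval w st (set_reg (set_reg rho vL a) vD j) (Nm vS) = s.
  exact: rS.
have hX (a : 'I_na) j : eval w st (set_reg (set_reg rho vL a) vD j)
    (Inp (Plus (Nm vOX) (Nm vK))) = u.
  by rewrite /= /set_reg /= rK (envOX Hr) (nth_encode_execution (init (ts x)) km).
apply/forallP/eqP => [H|H a].
  apply/setP => a; have := H a; rewrite holds_not negbK holds_eq.
  by rewrite (lab _ s) // (lab _ u) // => /eqP; do 2! case: (_ \in _).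
by rewrite holds_not negbK holds_eq (lab _ s) // (lab _ u) // H.
Qed.

Lemma run_table_matching st rho : env rho ->
  let st' := run_cmd w st rho (table tR vM eR) in
  (forall a', a' != tR -> st' a' = st a') /\
  (forall k (s : 'I_n), k < m -> (st' tR (k * n + s) != 0) = (s \in matched k)).
Proof.
move=> Hr; rewrite -(envM Hr); apply: run_table => // st' k s km _ H2.
set rho' := set_reg _ vS s.
have Hr' : env rho' by do 2! apply: env_bind => //.
rewrite (envM Hr) in km.
have hK : holds w st' rho' (Nm vK) = (k != 0) by [].
rewrite !(holds_or, holds_and) (@holds_match _ _ k s) // holds_eq !holds_not hK.
rewrite (@holds_cause _ _ _ s) // (holds_sum _ _ _ _ (envN Hr')).
case: k => [|k] in rho' H2 Hr' hK km *; rewrite /= !inE.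
  by rewrite orbF (_ : rho' vI = init (ts x)) ?(envI Hr').
congr (_ && (_ && _)); apply: eq_existsb => t.
rewrite holds_and (@holds_trans _ _ _ _ t s) // ?(@holds_prev _ _ _ _ _ k) //.
- by rewrite -(H2 k).
- exact: env_bind.
- exact: env_bind.
Qed.

Definition answer : bool :=
  (init (ts x) \in good) && ~~ [exists k : 'I_m,
    meets (ts x) (cause x) (execution x) k good_effect &&
    ~~ ((k.+1 < m) && meets (ts x) (cause x) (execution x) k.+1 good)].

Lemma run_algorithm : (run_cmd w (fun _ _ => 0) (fun=> 0) algorithm tG 0 != 0) = answer.
Proof.
rewrite /algorithm run_setup /=.
set rho := setup_env.
have Hr : env rho := env_setup.
have [_ G1] := run_table_good (fun _ _ => 0) Hr; set st1 := run_cmd _ _ _ _ in G1 *.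
have [G2 H2] := run_table_good_obj st1 Hr; set st2 := run_cmd _ _ _ _ in G2 H2 *.
have [G3 R3] := run_table_matching st2 Hr; set st3 := run_cmd _ _ _ _ in G3 R3 *.
rewrite /set_store eqxx /set_reg eqxx -/(holds w st3 rho eAnswer).
have hG (s : 'I_n) : (st3 tG (n * n + s) != 0) = (s \in good) by rewrite G3 // G2.
have hH (s : 'I_n) : (st3 tH (n * n + s) != 0) = (s \in good_effect) by rewrite G3 // H2.
rewrite holds_and holds_cell // holds_not (envN Hr) (envI Hr) hG.
congr (_ && ~~ _); rewrite (holds_sum _ _ _ _ (envM Hr)); apply: eq_existsb => k.
set rho' := set_reg rho vK k.
have Hr' : env rho' by apply: env_bind.
rewrite holds_and holds_not holds_and !(holds_sum _ _ _ _ (envN Hr')).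
have -> : holds w st3 rho' (Minus (Nm vM) (Plus (Nm vK) (Cst 1))) = (k.+1 < m).
  by rewrite /holds /= (envM Hr') -[rho' vK]/(k : nat); lia.
(* The guard [k + 1 < m] is kept as a hypothesis, since the contents of row [k + 1] of [tR] are
   known only under it. *)
congr (_ && ~~ _); [|apply: andb_id2l => km]; apply: eq_existsb => s.
- have Hs : env (set_reg rho' vS s) by apply: env_bind.
  by rewrite holds_and !holds_cell // (envN Hs) hH -[set_reg _ _ _ vK]/(k : nat) R3.
- have Hs : env (set_reg rho' vS s) by apply: env_bind.
  rewrite holds_and holds_next // holds_cell // (envN Hs) hG.
  by rewrite -[set_reg _ _ _ vK]/(k : nat) R3.
Qed.

(** No [Let] occurs after the setup, so nothing remains to be bounded there. *)
Lemma algorithm_ok : cmd_ok w (input_size w) (fun=> 0) algorithm.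
Proof. exact: cmd_ok_setup. Qed.

End Encoding.

Theorem theorem1 (R : realType) :
  polytime_decidable encode
    (fun x : cf_data =>
       let pi := Fin (execution x) in
       let Phi := objective_sat (effect x) (obj x) in
       [/\ forall s, s \in effect x -> terminal (ts x) s,
           [disjoint cause x & effect x],
           maximal_path (ts x) pi,
           visits (cause x) pi
         & Phi pi])
    (fun x : cf_data =>
       counterfactual_cause (dpref (ts x) R) (cause x)
         (objective_sat (effect x) (obj x)) (Fin (execution x))).
Proof.
apply: (cmd_polytime (c := algorithm) (a := tG)) => x [Et _ px pC _].
split; first exact: algorithm_ok.
rewrite run_algorithm (counterfactual_cause_dprefP (obj x) Et px pC).
split=> [/andP[iG /existsPn H]|[iG H]].
  split=> // -[k [kp mk nk]]; have := H (Ordinal kp); rewrite mk negbK => /andP[].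
  by move=> *; apply: nk.
apply/andP; split=> //; apply/existsPn => k; rewrite negb_and negbK.
case: (boolP (meets _ _ _ k _)) => //= mk; apply/negPn/negP => nk.
by apply: H; exists (nat_of_ord k); split=> // /andP; apply/negP.
Qed.
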